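(* Let $f:X\to Y$ be a quasi-isometry of complete CAT(0) spaces. Then the induced map $\partial_cf:\partial_cX\to\partial_cY$ is a homeomorphism, where $\partial_cX$ and $\partial_cY$ carry the direct limit topology.
   Context: A $(K,L)$-quasi-isometry $f:X\to Y$ is a map with $\frac1Kd(s,t)-L\le d(f(s),f(t))\le Kd(s,t)+L$ for all $s,t\in X$ and such that every $y\in Y$ is within distance less than $L$ of $f(X)$. For a geodesic $\gamma$ in a CAT(0) space, $\pi_\gamma$ denotes nearest point projection onto $\gamma$. $\gamma$ is $D$-contracting if for all $x,y$, $d(x,y)<d(x,\pi_\gamma(x))$ implies $d(\pi_\gamma(x),\pi_\gamma(y))<D$; it is contracting if it is $D$-contracting for some $D$. The visual boundary $\partial X$ is the set of classes $\gamma(\infty)$ of geodesic rays, two rays being equivalent (asymptotic) if they stay at bounded distance; each class has a unique representative starting at a given base point $x_0$. The cone topology on $\partial X$ has as neighborhood basis of $\gamma(\infty)$ (with $\gamma(0)=x_0$) the sets $U(\gamma,r,\epsilon)=\{\alpha(\infty):\alpha(0)=x_0,\ d(\alpha(t),\gamma(t))<\epsilon\ \forall t<r\}$. The contracting boundary is $\partial_cX=\{\alpha(\infty)\in\partial X:\alpha\text{ contracting}\}$. For $n\in\mathbb{N}$, $\partial^n_cX_{x_0}$ is the set of points of $\partial X$ represented by an $n$-contracting ray starting at $x_0$, with the subspace topology from the cone topology; the direct limit topology on $\partial_cX=\bigcup_n\partial_c^nX_{x_0}$ is the one in which $V$ is closed iff $V\cap\partial_c^nX_{x_0}$ is closed in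 $\partial_c^nX_{x_0}$ for all $n$ (it is independent of $x_0$). Induced map: fix base points $x_0\in X$ and $f(x_0)\in Y$. For a contracting ray $\gamma$ at $x_0$, $f\circ\gamma$ stays at bounded distance from a unique geodesic ray $\beta$ based at $f(x_0)$, and $\beta$ is contracting; $\partial_cf(\gamma(\infty)):=\beta(\infty)$. *)

(* Defs.v *)
From HB Require Import structures.
From mathcomp Require Import all_boot all_order all_algebra generic_quotient.
From mathcomp Require Import all_classical all_reals all_analysis.
Set Implicit Arguments.
Unset Strict Implicit.
Unset Printing Implicit Defensive.
Import Order.TTheory GRing.Theory Num.Theory.
Local Open Scope classical_set_scope.
Local Open Scope ring_scope.

Section Cat0.
Context {R : realType}.

Definition complete_space (X : metricType R) : Prop :=
  forall F : set_system X, ProperFilter F -> cauchy F -> exists l : X, F --> l.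

Definition plane_dist (p q : R * R) : R :=
  Num.sqrt ((p.1 - q.1) ^+ 2 + (p.2 - q.2) ^+ 2).

Definition geodesic_segment (X : metricType R) (x y : X) (c : R -> X) : Prop :=
  [/\ c 0 = x, c (mdist x y) = y &
      forall s t, 0 <= s <= mdist x y -> 0 <= t <= mdist x y ->
        mdist (c s) (c t) = `|s - t|].

Definition geodesic_space (X : metricType R) : Prop :=
  forall x y : X, exists c, geodesic_segment x y c.

Definition comparison_triangle (X : metricType R) (x y z : X)
    (x' y' z' : R * R) : Prop :=
  [/\ plane_dist x' y' = mdist x y, plane_dist x' z' = mdist x z &
      plane_dist y' z' = mdist y z].

(* When [p] lies on a geodesic segment from [x] to [y] and
   [plane_dist x' y' = mdist x y], these two equations force [p'] to be the
   point of the Euclidean segment [x', y'] at distance [mdist x p] from [x']. *)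
Definition comparison_point (X : metricType R) (x y p : X)
    (x' y' p' : R * R) : Prop :=
  plane_dist x' p' = mdist x p /\ plane_dist p' y' = mdist p y.

(* Two points on different sides of a triangle are on two sides issuing from a
   common vertex, here called [x]; for two points on the same side the
   comparison inequality is an equality. *)
Definition cat0 (X : metricType R) : Prop :=
  geodesic_space X /\
  forall (x y z : X) (c1 c2 : R -> X) (x' y' z' : R * R),
    geodesic_segment x y c1 -> geodesic_segment x z c2 ->
    comparison_triangle x y z x' y' z' ->
    forall (s t : R) (p' q' : R * R),
      0 <= s <= mdist x y -> 0 <= t <= mdist x z ->
      comparison_point x y (c1 s) x' y' p' ->
      comparison_point x z (c2 t) x' z' q' ->
      mdist (c1 s) (c2 t) <= plane_dist p' q'.

Definition quasi_isometry_with (X Y : metricType R) (K L : R) (f : X -> Y)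
    : Prop :=
  (forall s t, K^-1 * mdist s t - L <= mdist (f s) (f t) <= K * mdist s t + L)
  /\ (forall y, exists x, mdist y (f x) < L).

Definition quasi_isometry (X Y : metricType R) (f : X -> Y) : Prop :=
  exists K L : R, [/\ 1 <= K, 0 <= L & quasi_isometry_with K L f].

End Cat0.

Section Boundary.
Context {R : realType}.

Record ray (X : metricType R) := Ray {
  ray_fun :> {nonneg R} -> X;
  rayP : forall s t, mdist (ray_fun s) (ray_fun t) = `|s%:num - t%:num| }.

HB.instance Definition _ (X : metricType R) := gen_eqMixin (ray X).
HB.instance Definition _ (X : metricType R) := gen_choiceMixin (ray X).

Definition origin (X : metricType R) (g : ray X) : X := g 0%:nng.

Definition asymptotic (X : metricType R) : rel (ray X) :=
  fun g h => `[< exists C : R, forall t, mdist (g t) (h t) <= C >].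

Lemma asymptotic_refl (X : metricType R) : reflexive (@asymptotic X).
Proof. by move=> g; apply/asboolP; exists 0 => t; rewrite mdistxx. Qed.

Lemma asymptotic_sym (X : metricType R) : symmetric (@asymptotic X).
Proof.
by move=> g h; apply/asboolP/asboolP => -[C gh]; exists C => t;
  rewrite metric_sym.
Qed.

Lemma asymptotic_trans (X : metricType R) : transitive (@asymptotic X).
Proof.
move=> h g k /asboolP[C gh] /asboolP[D hk]; apply/asboolP; exists (C + D) => t.
by rewrite (le_trans (metric_triangle _ (h t) _))// lerD.
Qed.

Canonical asymptotic_equiv (X : metricType R) :=
  EquivRel (@asymptotic X) (@asymptotic_refl X) (@asymptotic_sym X)
    (@asymptotic_trans X).

Definition boundary (X : metricType R) : Type :=
  {eq_quot (@asymptotic_equiv X)}%qT.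
HB.instance Definition _ (X : metricType R) := Choice.on (boundary X).

(* The point [g(oo)] of the visual boundary. *)
Definition endpoint (X : metricType R) (g : ray X) : boundary X :=
  \pi_({eq_quot (@asymptotic_equiv X)})%qT g.

Lemma endpoint_eqP (X : metricType R) (g h : ray X) :
  endpoint g = endpoint h <->
  exists C : R, forall t, mdist (g t) (h t) <= C.
Proof.
split=> [/eqquotP/asboolP//|gh].
by apply/eqquotP/asboolP.
Qed.

Definition nearest_points (X : metricType R) (g : ray X) (x : X) : set X :=
  [set p | range g p /\ forall q, range g q -> mdist x p <= mdist x q].

(* In a complete CAT(0) space [nearest_points g x] is a singleton, so the
   default value of [xget] plays no role. *)
Definition ray_proj (X : metricType R) (g : ray X) (x : X) : X :=
  xget (origin g) (nearest_points g x).

Definition contracting_with (X : metricType R) (D : R) (g : ray X) : Prop :=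
  forall x y, mdist x y < mdist x (ray_proj g x) ->
    mdist (ray_proj g x) (ray_proj g y) < D.

Definition contracting (X : metricType R) (g : ray X) : Prop :=
  exists D : R, contracting_with D g.

Definition contracting_boundary (X : metricType R) : set (boundary X) :=
  [set p | exists2 g : ray X, contracting g & p = endpoint g].

(* The visual boundary with the cone topology based at [x0]. *)
Definition cone_boundary (X : metricType R) (x0 : X) : Type := boundary X.
HB.instance Definition _ (X : metricType R) (x0 : X) :=
  Choice.on (cone_boundary x0).

Definition cone_nbhs (X : metricType R) (g : ray X) (r e : R)
    : set (boundary X) :=
  [set p | exists a : ray X, [/\ origin a = origin g, p = endpoint a &
             forall t : {nonneg R}, t%:num < r -> mdist (a t) (g t) < e]].

Definition cone_open (X : metricType R) (x0 : X)
    : set_system (cone_boundary x0) :=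
  [set V | forall g : ray X, origin g = x0 -> V (endpoint g) ->
     exists r e : R, [/\ 0 < r, 0 < e & cone_nbhs g r e `<=` V]].

Section ConeTopology.
Context (X : metricType R) (x0 : X).

Lemma cone_openT : @cone_open X x0 setT.
Proof. by move=> g _ _; exists 1, 1; split. Qed.

Lemma cone_openI : setI_closed (@cone_open X x0).
Proof.
move=> A B oA oB g gx0 [Ag Bg].
have [r [e [r0 e0 sA]]] := oA g gx0 Ag.
have [s [d [s0 d0 sB]]] := oB g gx0 Bg.
exists (Num.max r s), (Num.min e d); split.
- by rewrite lt_max r0.
- by rewrite lt_min e0 d0.
- move=> p [a [ag pa near_g]]; split.
  + apply: sA; exists a; split=> // t tr.
    by have := near_g t; rewrite lt_max tr lt_min => /(_ isT) /andP[].
  + apply: sB; exists a; split=> // t ts.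
    by have := near_g t; rewrite lt_max ts orbT lt_min => /(_ isT) /andP[].
Qed.

Lemma cone_open_bigU (I : Type) (F : I -> set (cone_boundary x0)) :
  (forall i, cone_open (F i)) -> cone_open (\bigcup_i F i).
Proof.
move=> oF g gx0 [i _ Fg]; have [r [e [r0 e0 sF]]] := oF i g gx0 Fg.
by exists r, e; split=> // p /sF; exists i.
Qed.

HB.instance Definition _ := isOpenTopological.Build (cone_boundary x0)
  cone_openT cone_openI cone_open_bigU.

End ConeTopology.

Definition contracting_stratum (X : metricType R) (x0 : X) (n : nat)
    : set (cone_boundary x0) :=
  [set p | exists g : ray X,
     [/\ origin g = x0, contracting_with n%:R g & p = endpoint g]].

Lemma contracting_stratum_sub (X : metricType R) (x0 : X) (n : nat) :
  @contracting_stratum X x0 n `<=` @contracting_boundary X.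
Proof. by move=> p [g [_ gn pg]]; exists g => //; exists n%:R. Qed.

(* The inclusion of the n-th stratum, which has the topology of a subspace of
   [cone_boundary x0], into the contracting boundary. *)
Definition stratum_incl (X : metricType R) (x0 : X) (n : nat)
    (p : set_type (@contracting_stratum X x0 n))
    : set_type (@contracting_boundary X) :=
  exist _ (set_val p)
    (mem_set (contracting_stratum_sub (set_valP p))).

(* The contracting boundary with the direct limit topology based at [x0]. *)
Definition limit_boundary (X : metricType R) (x0 : X) : Type :=
  set_type (@contracting_boundary X).
HB.instance Definition _ (X : metricType R) (x0 : X) :=
  Choice.on (limit_boundary x0).

Definition limit_closed (X : metricType R) (x0 : X)
    : set_system (limit_boundary x0) :=
  [set V | forall n : nat, closed (@stratum_incl X x0 n @^-1` V)].

Section LimitTopology.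
Context (X : metricType R) (x0 : X).

Definition limit_open : set_system (limit_boundary x0) :=
  [set V | limit_closed (~` V)].

Lemma limit_openT : limit_open setT.
Proof. by move=> n; rewrite setCT preimage_set0; exact: closed0. Qed.

Lemma limit_openI : setI_closed limit_open.
Proof.
by move=> A B oA oB n; rewrite setCI preimage_setU; apply: closedU.
Qed.

Lemma limit_open_bigU (I : Type) (F : I -> set (limit_boundary x0)) :
  (forall i, limit_open (F i)) -> limit_open (\bigcup_i F i).
Proof.
move=> oF n; rewrite setC_bigcup preimage_bigcap.
by apply: closed_bigI => i _; exact: oF.
Qed.

HB.instance Definition _ := isOpenTopological.Build (limit_boundary x0)
  limit_openT limit_openI limit_open_bigU.

Lemma limit_closedP (V : set (limit_boundary x0)) :
  closed V <-> forall n : nat, closed (@stratum_incl X x0 n @^-1` V).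
Proof.
rewrite -openC (_ : open (~` V) = limit_closed (~` ~` V)) //.
by rewrite setCK.
Qed.

End LimitTopology.

(* [f \o g] and [b] need not be parametrized at comparable speeds. *)
Definition stays_near (X Y : metricType R) (f : X -> Y) (g : ray X)
    (b : ray Y) : Prop :=
  exists C : R, forall t, exists s, mdist (f (g t)) (b s) <= C.

Definition induced_map (X Y : metricType R) (f : X -> Y) (x0 : X)
    (h : limit_boundary x0 -> limit_boundary (f x0)) : Prop :=
  forall (p : limit_boundary x0) (g : ray X),
    origin g = x0 -> contracting g -> set_val p = endpoint g ->
    exists b : ray Y, [/\ origin b = f x0, contracting b,
      stays_near f g b & set_val (h p) = endpoint b].

End Boundary.

Definition homeomorphism (T U : topologicalType) (h : T -> U) : Prop :=
  continuous h /\
  exists k : U -> T, [/\ cancel h k, cancel k h & continuous k].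

(* Main.v *)
Require Import Defs.
From mathcomp Require Import all_boot all_order all_algebra.
From mathcomp Require Import all_classical all_reals all_analysis.
From mathcomp Require Import ring lra.
Set Implicit Arguments.
Unset Strict Implicit.
Unset Printing Implicit Defensive.
Import Order.TTheory GRing.Theory Num.Theory numFieldNormedType.Exports.
Local Open Scope classical_set_scope.
Local Open Scope ring_scope.

(** Being contracting is not visibly invariant under quasi-isometries, so it is
    traded for a recurrence property that is: a chain of bounded jumps between
    two points [p], [q] of the ray, of length at most [C d(p, q)], passes within
    [N] of the ray at a distance from [p] which is a definite but small fraction
    of [d(p, q)].  A contracting ray has it because a chain far from the ray
    makes little progress in projection.  Conversely, recurrence applied to the
    path that climbs from a projection [p = pi(x)] towards [x], crosses over to
    the geodesic [x, m] and follows it down to [m] in the ray shows that [x, m]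
    passes near [p].  With [m] the midpoint of [pi(x)] and [pi(y)] far apart, the
    angle at [m] between [x] and [y] is then obtuse, so [d(x, y) >= d(m, x)], and
    the ray is contracting.  The constants are uniform in the ray.

    The image ray is the limit of the geodesics from its origin to [f (a m)]:
    these stay close to the image of [a], since their preimages are
    quasi-geodesics with endpoints near a contracting ray, and convexity makes
    them a Cauchy family.  Uniform constants on each stratum and convexity of the
    distance between rays with a common origin give continuity. *)

(** * Comparison in CAT(0) spaces *)

Section Cat0Geometry.
Context {R : realType}.

Lemma plane_distP (p q : R * R) (a : R) : 0 <= a ->
  (p.1 - q.1) ^+ 2 + (p.2 - q.2) ^+ 2 = a ^+ 2 -> plane_dist p q = a.
Proof. by move=> a0 pq; rewrite /plane_dist pq sqrtr_sqr ger0_norm. Qed.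

Context (X : metricType R).
Implicit Types (x y z m : X) (c : R -> X).

Lemma mdist_triangle_rev x y z : `|mdist x y - mdist x z| <= mdist y z.
Proof.
have := metric_triangle x z y; have := metric_triangle x y z.
by rewrite (metric_sym z y) ler_norml => h1 h2; apply/andP; split; lra.
Qed.

Lemma segment_dist x y c s : geodesic_segment x y c -> 0 <= s <= mdist x y ->
  mdist x (c s) = s /\ mdist (c s) y = mdist x y - s.
Proof.
case=> c0 c1 cd /andP[s0 s1]; have d0 := mdist_ge0 x y; split.
  by rewrite -{1}c0 cd ?lexx ?s0 ?d0// sub0r normrN ger0_norm.
by rewrite -{1}c1 cd ?lexx ?s0 ?d0// distrC ger0_norm// subr_ge0.
Qed.

Lemma segment_rev x y c : geodesic_segment x y c ->
  geodesic_segment y x (fun t => c (mdist x y - t)).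
Proof.
case=> c0 c1 cd; split.
- by rewrite subr0.
- by rewrite (metric_sym y x) subrr.
- rewrite (metric_sym y x) => s t /andP[s0 s1] /andP[t0 t1].
  by rewrite cd ?subr_ge0 ?s1 ?t1 ?gerBl// opprB addrC addrA subrK distrC.
Qed.

Lemma segment_prefix x y c s : geodesic_segment x y c -> 0 <= s <= mdist x y ->
  geodesic_segment x (c s) c.
Proof.
move=> gc /[dup] hs /andP[s0 s1]; have [xs _] := segment_dist gc hs.
case: gc => c0 c1 cd; split=> //; first by rewrite xs.
rewrite xs => u v /andP[u0 us] /andP[v0 vs].
by apply: cd; rewrite ?u0 ?v0 ?(le_trans us)// (le_trans vs).
Qed.

Section Cat0.
Hypothesis cat0_X : cat0 X.

(* The right-hand side is the squared distance of the comparison points in a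
   Euclidean triangle with sides [mdist m x], [mdist m y] and [mdist x y]. *)
Lemma cat0_comparison m x y c1 c2 (l u : R) :
  geodesic_segment m x c1 -> geodesic_segment m y c2 ->
  0 <= l <= 1 -> 0 <= u <= 1 ->
  mdist (c1 (l * mdist m x)) (c2 (u * mdist m y)) ^+ 2 <=
    (l * mdist m x) ^+ 2 + (u * mdist m y) ^+ 2
    - l * u * (mdist m x ^+ 2 + mdist m y ^+ 2 - mdist x y ^+ 2).
Proof.
move=> gc1 gc2 /andP[l0 l1] /andP[u0 u1].
have A0 := mdist_ge0 m x; have B0 := mdist_ge0 m y; have e0 := mdist_ge0 x y.
have tr1 := metric_triangle x m y; have := mdist_triangle_rev m x y.
rewrite (metric_sym x m) in tr1.
have lA : 0 <= l * mdist m x <= mdist m x by rewrite mulr_ge0//= ler_piMl.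
have uB : 0 <= u * mdist m y <= mdist m y by rewrite mulr_ge0//= ler_piMl.
have [d1 d2] := segment_dist gc1 lA; have [d3 d4] := segment_dist gc2 uB.
case/andP: lA => lA0 lA1; case/andP: uB => uB0 uB1.
move: cat0_X => [_ /(_ m x y c1 c2 (0, 0) (mdist m x, 0))].
rewrite /comparison_triangle /comparison_point.
move: (mdist m x) (mdist m y) (mdist x y) A0 B0 e0 tr1 lA0 lA1 uB0 uB1 gc1 gc2
  d1 d2 d3 d4 => A B e A0 B0 e0 tr1 lA0 lA1 uB0 uB1 gc1 gc2
  d1 d2 d3 d4 comp tr2.
(* The comparison triangle has [m] at the origin and [x] at [(A, 0)]. Here [a] is the first
   coordinate of the point for [y]; the bound on its square leaves room for the second one. *)
have [a [aA aB]] : exists a,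
    2 * A * a = A ^+ 2 + B ^+ 2 - e ^+ 2 /\ a ^+ 2 <= B ^+ 2.
  have [A00|A00] := eqVneq A 0.
    exists 0; rewrite expr0n sqr_ge0; split=> //.
    have -> : B = e by move: tr2; rewrite A00 ler_norml => /andP[? ?]; lra.
    by rewrite A00; ring.
  have {}A0 : 0 < A by rewrite lt_neqAle eq_sym A00.
  exists ((A ^+ 2 + B ^+ 2 - e ^+ 2) / (2 * A)); split; first by field.
  move: tr2; rewrite ler_norml => /andP[t1 t2].
  rewrite expr_div_n ler_pdivrMr; last by rewrite exprn_gt0// mulr_gt0.
  rewrite -subr_ge0.
  (* Heron's factorization: each factor is nonnegative by a triangle inequality. *)
  have -> : B ^+ 2 * (2 * A) ^+ 2 - (A ^+ 2 + B ^+ 2 - e ^+ 2) ^+ 2 =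
    ((A + B - e) * (A + B + e)) * ((e - (A - B)) * (e + (A - B))) by ring.
  by apply: mulr_ge0; apply: mulr_ge0; lra.
have rt : Num.sqrt (B ^+ 2 - a ^+ 2) ^+ 2 = B ^+ 2 - a ^+ 2.
  by rewrite sqr_sqrtr// subr_ge0.
move: (Num.sqrt _) rt => r rt.
have dA : plane_dist (0, 0) (A, 0) = A by apply: plane_distP => //=; ring.
have dB : plane_dist (0, 0) (a, r) = B by apply: plane_distP => //=; lra.
have dE : plane_dist (A, 0) (a, r) = e by apply: plane_distP => //=; lra.
have := comp (a, r) gc1 gc2 (And3 dA dB dE) (l * A) (u * B) (l * A, 0)
  (u * a, u * r).
rewrite d1 d2 d3 d4 lA0 lA1 uB0 uB1.
have {dA} dA : plane_dist (0, 0) (l * A, 0) = l * A.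
  by apply: plane_distP => //=; ring.
have dA' : plane_dist (l * A, 0) (A, 0) = A - l * A.
  by apply: plane_distP => /=; [lra | ring].
have {dB} dB : plane_dist (0, 0) (u * a, u * r) = u * B.
  apply: plane_distP => //=; rewrite !sub0r !sqrrN !exprMn rt; ring.
have dB' : plane_dist (u * a, u * r) (a, r) = B - u * B.
  apply: plane_distP => /=; first lra.
  rewrite -[_ - a](_ : (u - 1) * a = _); last by ring.
  by rewrite -[_ - r](_ : (u - 1) * r = _); [rewrite !exprMn rt; ring | ring].
move=> /(_ isT isT (conj dA dA') (conj dB dB')) le_pq.
apply: (@le_trans _ _ (plane_dist (l * A, 0) (u * a, u * r) ^+ 2)).
  by rewrite ler_sqr// nnegrE ?mdist_ge0// sqrtr_ge0.
rewrite /plane_dist /= sqr_sqrtr ?addr_ge0 ?sqr_ge0//.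
rewrite sub0r sqrrN !exprMn rt -aA.
by rewrite le_eqVlt; apply/orP; left; apply/eqP; ring.
Qed.

(** For equal ratios the bound of [cat0_comparison] is a perfect square. *)
Lemma cat0_convex m x y c1 c2 (l : R) :
  geodesic_segment m x c1 -> geodesic_segment m y c2 -> 0 <= l <= 1 ->
  mdist (c1 (l * mdist m x)) (c2 (l * mdist m y)) <= l * mdist x y.
Proof.
move=> gc1 gc2 hl; have /andP[l0 _] := hl.
have := cat0_comparison gc1 gc2 hl hl.
rewrite (_ : _ - _ = (l * mdist x y) ^+ 2); last by ring.
by rewrite ler_sqr// nnegrE ?mulr_ge0 ?mdist_ge0.
Qed.

(* A triangle whose angle at [m], measured on two inner points of the sides, is
   at least [pi / 2] has [x, y] as its longest side. *)
Lemma cat0_obtuse m x y c1 c2 (s t : R) :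
  geodesic_segment m x c1 -> geodesic_segment m y c2 ->
  0 < s <= mdist m x -> 0 < t <= mdist m y ->
  s ^+ 2 + t ^+ 2 <= mdist (c1 s) (c2 t) ^+ 2 -> mdist m x <= mdist x y.
Proof.
move=> gc1 gc2 /andP[s0 s1] /andP[t0 t1] st.
have A0 := lt_le_trans s0 s1; have B0 := lt_le_trans t0 t1.
have l1 : 0 <= s / mdist m x <= 1.
  by rewrite (divr_ge0 (ltW s0) (mdist_ge0 _ _))/= ler_pdivrMr// mul1r.
have l2 : 0 <= t / mdist m y <= 1.
  by rewrite (divr_ge0 (ltW t0) (mdist_ge0 _ _))/= ler_pdivrMr// mul1r.
have := cat0_comparison gc1 gc2 l1 l2.
rewrite !divfK ?gt_eqF// => /(le_trans st).
(* The factor multiplying the two ratios is nonpositive, so the squares of the sides at [m] add up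
   to at most that of [[x, y]]. *)
rewrite lerBDl gerDr pmulr_rle0 ?mulr_gt0 ?invr_gt0// => ab.
have B2 := sqr_ge0 (mdist m y).
by rewrite -ler_sqr ?nnegrE ?mdist_ge0//; lra.
Qed.

End Cat0.
End Cat0Geometry.
(** * Rays and projections *)

Section Rays.
Context {R : realType} {X : metricType R}.
Implicit Types (g : ray X) (x y : X) (s t : R).

(** Real parameters let rays serve as geodesic segments and keep the arithmetic of times in [R]. *)
Definition ray_at g t : X := g `|t|%:nng.

Lemma ray_atE g (t : {nonneg R}) : ray_at g t%:num = g t.
Proof.
by rewrite /ray_at; congr (ray_fun g _); apply/val_inj; rewrite /= ger0_norm.
Qed.

Lemma ray_at0 g : ray_at g 0 = origin g.
Proof.
by rewrite /ray_at; congr (ray_fun g _); apply/val_inj; rewrite /= normr0.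
Qed.

Lemma ray_dist g s t : 0 <= s -> 0 <= t ->
  mdist (ray_at g s) (ray_at g t) = `|s - t|.
Proof.
by move=> s0 t0; rewrite /ray_at rayP /= (ger0_norm s0) (ger0_norm t0).
Qed.

Lemma range_rayP g x : range g x <-> exists2 t, 0 <= t & x = ray_at g t.
Proof.
split=> [[t _ <-]|[t t0 ->]]; last by exists (`|t|%:nng).
by exists t%:num => //; rewrite ray_atE.
Qed.

Lemma ray_at_range g t : range g (ray_at g t).
Proof. by exists (`|t|%:nng). Qed.

Lemma ray_segment g t : 0 <= t ->
  geodesic_segment (origin g) (ray_at g t) (ray_at g).
Proof.
move=> t0; rewrite /geodesic_segment -ray_at0 ray_dist// sub0r normrN.
rewrite ger0_norm//.
by split=> // u v /andP[u0 _] /andP[v0 _]; rewrite ray_dist.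
Qed.

Lemma continuous_dist_ray g x : continuous (fun t => mdist x (ray_at g t)).
Proof.
move=> t; apply/cvgrPdist_le => /= e e0.
apply/nbhs_ballP; exists e => //= u; rewrite /ball /= => /ltW; apply: le_trans.
rewrite (le_trans (mdist_triangle_rev _ _ _))// /ray_at rayP /=.
exact: ler_dist_dist.
Qed.

(** After time [2 d(x, g(0))] the ray is farther from [x] than its origin is, so the minimum over a
    compact interval is global. *)
Lemma ray_nearest g x : nearest_points g x (ray_proj g x).
Proof.
rewrite /ray_proj; apply: xgetPex.
pose f t := mdist x (ray_at g t).
have f0 := mdist_ge0 x (ray_at g 0).
have M0 : 0 <= 2 * f 0 by rewrite mulr_ge0.
have [c + cmin] := EVT_min M0 (continuous_subspaceT (@continuous_dist_ray g x)).
rewrite in_itv/= => /andP[c0 c1].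
exists (ray_at g c); split; first exact: ray_at_range.
move=> _ /range_rayP[t t0 ->].
have [tM|tM] := leP t (2 * f 0); first by apply: cmin; rewrite in_itv/= t0.
rewrite (le_trans (cmin 0 _)) ?in_itv/= ?lexx//.
have := metric_triangle (ray_at g 0) x (ray_at g t).
rewrite ray_dist// sub0r normrN ger0_norm// (metric_sym _ x).
by rewrite -[mdist x (ray_at g 0)]/(f 0) => h; lra.
Qed.

Lemma ray_proj_range g x : range g (ray_proj g x).
Proof. by case: (ray_nearest g x). Qed.

Lemma ray_proj_le g x q : range g q -> mdist x (ray_proj g x) <= mdist x q.
Proof. by case: (ray_nearest g x) => _; apply. Qed.

(** A point of the ray closer to [c s] than the projection of [x] would, by the triangle inequality,
    also be closer to [x]. *)
Lemma ray_proj_segment g x c s :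
  geodesic_segment x (ray_proj g x) c -> 0 <= s <= mdist x (ray_proj g x) ->
  forall q, range g q -> mdist (c s) (ray_proj g x) <= mdist (c s) q.
Proof.
move=> gc hs q gq; have [xs sp] := segment_dist gc hs.
have := ray_proj_le x gq; have := metric_triangle x (c s) q; lra.
Qed.

Lemma contracting_with_le g (D D' : R) : D <= D' ->
  contracting_with D g -> contracting_with D' g.
Proof. by move=> DD' gD x y xy; exact: lt_le_trans (gD _ _ xy) DD'. Qed.

End Rays.
(** * Chains and recurrence *)

Lemma last_true (P : pred nat) a b : P a -> (a <= b)%N ->
  exists i, [/\ (a <= i <= b)%N, P i & forall j, (i < j <= b)%N -> ~~ P j].
Proof.
move=> Pa ab; pose Q i := (a <= i <= b)%N && P i.
have exQ : exists i, Q i by exists a; rewrite /Q leqnn ab.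
have ubQ i : Q i -> (i <= b)%N by case/andP => /andP[].
case: (ex_maxnP exQ ubQ) => i /andP[hi Pi] imax.
exists i; split=> // j /andP[ij jb].
apply/negP => Pj; move: (ij); rewrite ltnNge imax// /Q jb Pj !andbT.
exact: leq_trans (andP hi).1 (ltnW ij).
Qed.

Lemma first_true (P : pred nat) a b : P b -> (a <= b)%N ->
  exists i, [/\ (a <= i <= b)%N, P i & forall j, (a <= j < i)%N -> ~~ P j].
Proof.
move=> Pb ab; pose Q i := (a <= i <= b)%N && P i.
have exQ : exists i, Q i by exists b; rewrite /Q leqnn ab.
case: (ex_minnP exQ) => i /andP[/andP[ai ib] Pi] imin.
exists i; split=> //; first by rewrite ai.
move=> j /andP[aj ji]; apply/negP => Pj; move: (ji).
by rewrite ltnNge imin// /Q aj Pj (ltnW (leq_trans ji ib)).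
Qed.

Section Chains.
Context {R : realType} {X : metricType R}.
Implicit Types (g : ray X) (z : nat -> X) (C D : R).

Definition steps C n z := forall i, (i < n)%N -> mdist (z i) (z i.+1) <= C.

Lemma steps_dist C n z i j : steps C n z -> (i <= j <= n)%N ->
  mdist (z i) (z j) <= C * (j - i)%:R.
Proof.
move=> zC /andP[ij]; rewrite -(subnKC ij) addKn.
elim: (j - i)%N => [|k IH] ik; first by rewrite addn0 mdistxx mulr0.
rewrite addnS (le_trans (metric_triangle _ (z (i + k)%N) _))//.
rewrite -natr1 mulrDr mulr1 lerD//; last by apply: zC; rewrite -addnS.
by apply: IH; rewrite (leq_trans _ ik)// leq_add2l.
Qed.

Lemma steps_shift C n z k :
  steps C n z -> steps C (n - k) (fun i => z (k + i)%N).
Proof. by move=> zC i ik; rewrite addnS; apply: zC; rewrite -ltn_subRL. Qed.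

Lemma steps_sub C n m z : (m <= n)%N -> steps C n z -> steps C m z.
Proof. by move=> mn zC i im; apply: zC; exact: leq_trans im mn. Qed.

Definition height g x := mdist x (ray_proj g x).

Section Excursion.
Variables (g : ray X) (C D : R) (M : nat).
Hypotheses (gD : contracting_with D g) (C0 : 0 <= C) (D0 : 0 <= D).
Hypothesis M0 : (0 < M)%N.

(** Cut the chain into blocks of [M] steps. A block has length at most [C M], less than the height
    of its first point, so contraction bounds the drift of each block by [D]. *)
Lemma high_drift n z : steps C n z ->
  (forall i, (i <= n)%N -> C * M%:R < height g (z i)) ->
  mdist (ray_proj g (z 0%N)) (ray_proj g (z n)) <= D * (n%:R / M%:R + 1).
Proof.
have M0' : 0 < M%:R :> R by rewrite ltr0n.
have short k y : (k <= M)%N -> steps C k y -> C * M%:R < height g (y 0%N) ->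
    mdist (ray_proj g (y 0%N)) (ray_proj g (y k)) <= D.
  move=> kM yC hy; apply/ltW/gD; apply: le_lt_trans hy.
  rewrite (le_trans (steps_dist yC (i := 0) (j := k) _)) ?leqnn//.
  by rewrite subn0 ler_wpM2l// ler_nat.
elim/ltn_ind: n z => n IH z zC hz.
have [nM|Mn] := leqP n M.
  rewrite (le_trans (short _ _ nM zC _)) ?hz//.
  by rewrite ler_peMr// lerDr divr_ge0.
rewrite (le_trans (metric_triangle _ (ray_proj g (z M)) _))//.
have : mdist (ray_proj g (z M)) (ray_proj g (z n)) <=
    D * ((n - M)%:R / M%:R + 1).
  have /(_ _ (fun i => z (M + i)%N)) := IH (n - M)%N.
  rewrite addn0 subnKC ?(ltnW Mn)//; apply.
  - by rewrite ltn_subrL M0 (leq_trans _ Mn).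
  - exact: steps_shift.
  - by move=> i im; apply: hz; rewrite -leq_subRL// ltnW.
have := short _ _ (leqnn M) (steps_sub (ltnW Mn) zC) (hz 0%N isT).
rewrite natrB ?(ltnW Mn)// mulrBl divff ?gt_eqF// subrK => h1 h2.
by rewrite mulrDr mulr1 [leRHS]addrC; exact: lerD.
Qed.

(** The two ends may be low. The first and the last jump each have a high endpoint, from which
    contraction bounds their drift by [D]; this turns the summand 1 into 3. *)
Lemma excursion_drift n z : (1 < n)%N -> steps C n z ->
  (forall i, (0 < i < n)%N -> C * M%:R < height g (z i)) ->
  mdist (ray_proj g (z 0%N)) (ray_proj g (z n)) <= D * (n%:R / M%:R + 3).
Proof.
have M1 : 1 <= M%:R :> R by rewrite ler1n.
case: n => [|[|n]]// _ zC hz.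
have step i j : (0 < i < n.+2)%N -> mdist (z i) (z j) <= C ->
    mdist (ray_proj g (z i)) (ray_proj g (z j)) <= D.
  move=> /hz hi ij; apply/ltW/gD; apply: le_lt_trans hi.
  by rewrite (le_trans ij)// ler_peMr.
have h1 : mdist (ray_proj g (z 0%N)) (ray_proj g (z 1%N)) <= D.
  by rewrite metric_sym step// metric_sym zC.
have h2 : mdist (ray_proj g (z n.+1)) (ray_proj g (z n.+2)) <= D.
  by rewrite step ?leqnn// zC.
have h3 : mdist (ray_proj g (z 1%N)) (ray_proj g (z n.+1)) <=
    D * (n%:R / M%:R + 1).
  apply: (@high_drift n (fun i => z i.+1)) => i i_n; first by rewrite zC// ltnW.
  by apply: hz.
apply: (@le_trans _ _ (D + D * (n%:R / M%:R + 1) + D)).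
  rewrite (le_trans (metric_triangle _ (ray_proj g (z n.+1)) _))// lerD//.
  by rewrite (le_trans (metric_triangle _ (ray_proj g (z 1%N)) _))// lerD.
rewrite -subr_ge0 (_ : _ - _ = D * (n.+2%:R - n%:R) / M%:R); last by ring.
by rewrite divr_ge0// mulr_ge0// subr_ge0 ler_nat leqW.
Qed.

End Excursion.

(** To save constants, [C] bounds the jumps, the length ratio and the upper fraction, while [N] is
    the threshold, the width of the neighbourhood and the lower fraction. *)
Definition recurrent (C N : R) g := forall p q, range g p -> range g q ->
  N <= mdist p q -> forall n z, z 0%N = p -> z n = q -> steps C n z ->
  n%:R <= C * mdist p q ->
  exists i, [/\ (i <= n)%N, exists2 w, range g w & mdist (z i) w <= N &
    mdist p q / N <= mdist (z i) p <= mdist p q / C].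

(** If no such point exists, the chain leaves its last low point near [p] and is next low only
    beyond distance [l / C]. In between it is high, so its projection cannot drift that far in the
    number of steps available. *)
Lemma contracting_recurrent (D C : R) : 1 <= C ->
  exists N, 1 <= N /\ forall g, contracting_with D g -> recurrent C N g.
Proof.
move=> C1; have C0 : 0 < C by lra.
wlog D0 : D / 0 <= D.
  move=> /(_ (Num.max D 0)); rewrite le_max lexx orbT => /(_ isT)[N [N1 HN]].
  exists N; split=> // g gD; apply: HN; apply: contracting_with_le gD.
  by rewrite le_max lexx.
(* With at most [C l] steps, this [M] keeps the proportional part of the drift below [l / (4 C)]. *)
pose M := (Num.truncn (4 * C ^+ 2 * D)).+1.
have HM : 4 * C ^+ 2 * D <= M%:R by apply/ltW/truncnS_gt.
have M0 : 0 < M%:R :> R by rewrite ltr0n.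
(* Low means height at most [N0]. In [S] below, [2 N0] pays for two low heights, [3 D] for the
   constant part of the drift and [C] for a single jump. *)
pose N0 := C * M%:R; have N00 : 0 <= N0 by rewrite mulr_ge0// ltW.
pose S := 2 * N0 + 3 * D + C.
have S0 : 0 <= S by rewrite /S; lra.
pose N := 2 * C * S + 4 * C + N0 + 1.
have CS : 0 <= C * S by rewrite mulr_ge0// ltW.
have N1 : 1 <= N by rewrite /N; lra.
exists N; split=> // g gD p q gp gq Npq n z z0 zn zC nC.
set l := mdist p q in Npq nC *.
have l0 : 0 < l by lra.
have [//|nG] := pselect (exists i, [/\ (i <= n)%N,
  exists2 w, range g w & mdist (z i) w <= N &
  l / N <= mdist (z i) p <= l / C]).
have good i : (i <= n)%N -> height g (z i) <= N0 ->
    l / N <= mdist (z i) p -> l / C < mdist (z i) p.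
  move=> i_n hi li; rewrite ltNge; apply/negP => iC; apply: nG.
  exists i; split=> //; last by rewrite li.
  exists (ray_proj g (z i)); first exact: ray_proj_range.
  by rewrite (le_trans hi)// /N; lra.
have range_low x : range g x -> height g x <= N0.
  by move=> gx; rewrite /height (le_trans (ray_proj_le x gx))// mdistxx.
pose A i := (height g (z i) <= N0) && (mdist (z i) p < l / N).
have A0 : A 0%N.
  by rewrite /A z0 range_low// mdistxx divr_gt0//; lra.
have [i0 [/andP[_ i0n] /andP[low0 near0] last0]] := last_true A0 (leq0n n).
have nAn : ~~ A n.
  rewrite /A zn range_low//= -leNgt metric_sym -/l ler_pdivrMr; last by lra.
  by rewrite ler_peMr// ltW.
have {i0n} i0n : (i0 < n)%N.
  rewrite ltn_neqAle i0n andbT; apply: contra nAn => /eqP <-.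
  by rewrite /A low0.
have lown : height g (z n) <= N0 by rewrite range_low// zn.
have [i1 [/andP[i01 i1n] low1 first1]] :=
  @first_true (fun i => height g (z i) <= N0) i0.+1 n lown i0n.
have far1 : l / C < mdist (z i1) p.
  apply: good => //; rewrite leNgt; apply/negP => near1.
  by have := last0 i1; rewrite i01 i1n /A low1 near1 => /(_ isT).
have lCN : l / N <= l / (4 * C).
  by rewrite ler_wpM2l ?(ltW l0)// lef_pV2 ?posrE ?mulr_gt0//; rewrite /N; lra.
have l4 : l / C = 4 * (l / (4 * C)) by field; lra.
have lS : S < 2 * (l / (4 * C)).
  rewrite (_ : 2 * _ = l / (2 * C)); last by field; lra.
  rewrite ltr_pdivlMr ?mulr_gt0//; apply: lt_le_trans Npq; rewrite /N; lra.
have d01 := metric_triangle (z i1) (z i0) p.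
suff : mdist (z i1) (z i0) <= S + l / (4 * C) by lra.
(* For adjacent low points there is no excursion and one jump suffices. *)
have [i1E|i1E] := eqVneq i1 i0.+1.
  rewrite i1E metric_sym (le_trans (zC _ i0n))//.
  have : 0 <= l / (4 * C) by rewrite divr_ge0//; lra.
  by rewrite /S; lra.
have k1 : (1 < i1 - i0)%N.
  by rewrite ltn_subRL addn1 ltn_neqAle eq_sym i1E.
have drift : mdist (ray_proj g (z i0)) (ray_proj g (z i1)) <=
    D * ((i1 - i0)%:R / M%:R + 3).
  have /= := @excursion_drift g C D M gD (ltW C0) D0 isT (i1 - i0)
    (fun i => z (i0 + i)%N) k1.
  rewrite addn0 subnKC ?(ltnW i01)//; apply.
    by apply: (steps_sub (leq_sub2r _ i1n)); exact: steps_shift.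
  move=> i /andP[ipos ii]; rewrite ltNge; apply: first1.
  by rewrite -addn1 leq_add2l ipos -ltn_subRL.
have kM : D * ((i1 - i0)%:R / M%:R) <= l / (4 * C).
  rewrite mulrA ler_pdivrMr//; apply: (@le_trans _ _ (D * (C * l))).
    rewrite ler_wpM2l// (le_trans _ nC)// ler_nat.
    by rewrite (leq_trans (leq_subr _ _)).
  have -> : D * (C * l) = l / (4 * C) * (4 * C ^+ 2 * D) by field; lra.
  by rewrite ler_wpM2l// divr_ge0//; lra.
have t1 := metric_triangle (z i1) (ray_proj g (z i1)) (z i0).
have := metric_triangle (ray_proj g (z i1)) (ray_proj g (z i0)) (z i0).
rewrite (metric_sym (ray_proj g (z i0)) (z i0)) -/(height g _).
rewrite -/(height g _) in t1.
rewrite mulrDr in drift; rewrite (metric_sym _ (ray_proj g (z i0))).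
by rewrite /S; lra.
Qed.

End Chains.

(** * From recurrence to contraction *)

Section RecurrentContracting.
Context {R : realType} {X : metricType R}.
Implicit Types (g : ray X) (x y u v w : X).

Definition linked (P : X -> Prop) (C : R) n u v := exists z,
  [/\ z 0%N = u, z n = v, steps C n z & forall i, (i <= n)%N -> P (z i)].

Lemma linked_cat P C n m u v w :
  linked P C n u v -> linked P C m v w -> linked P C (n + m) u w.
Proof.
move=> [z1 [z10 z1n z1C z1P]] [z2 [z20 z2m z2C z2P]].
exists (fun i => if (i <= n)%N then z1 i else z2 (i - n)%N); split=> //.
- have [|_] := leqP (n + m) n; last by rewrite addKn.
  rewrite -{2}(addn0 n) leq_add2l leqn0 => /eqP m0.
  by rewrite m0 addn0 -z2m m0 z20.
- move=> i im; have [i_n|ni] := leqP i n; last first.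
    by rewrite ltnNge ltnW//= subSn ?(ltnW ni)// z2C// ltn_subLR// ltnW.
  have [i_n'|] := ltnP i n; first exact: z1C.
  move=> ni; have this : i = n by apply/eqP; rewrite eqn_leq i_n.
  rewrite this.
  rewrite subSnn z1n -z20; apply: z2C.
  by move: im; rewrite this -{1}(addn0 n) ltn_add2l.
- move=> i im; have [|ni] := leqP i n; first exact: z1P.
  by apply: z2P; rewrite leq_subLR.
Qed.

Lemma linked_sym P C n u v : linked P C n u v -> linked P C n v u.
Proof.
move=> [z [z0 zn zC zP]]; exists (fun i => z (n - i)%N); split.
- by rewrite subn0.
- by rewrite subnn.
- move=> i i_n; rewrite metric_sym -(subnSK i_n) zC// ltn_subrL.
  by rewrite (leq_trans _ i_n).
- by move=> i _; apply: zP; exact: leq_subr.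
Qed.

Lemma linked_segment (P : X -> Prop) x y c a b : geodesic_segment x y c ->
  0 <= a -> a <= b -> b <= mdist x y ->
  (forall s, a <= s <= b -> P (c s)) ->
  exists2 n, n%:R <= b - a + 1 & linked P 1 n (c a) (c b).
Proof.
move=> [_ _ cd] a0 ab bd cP.
(* Unit sampling, clipped at [b]. *)
pose t (i : nat) := Num.min (a + i%:R) b.
have ht i : a <= t i <= b.
  by rewrite /t le_min lerDl ler0n ab ge_min lexx orbT.
have ht' i : 0 <= t i <= mdist x y.
  by have /andP[t1 t2] := ht i; apply/andP; split; lra.
exists (Num.truncn (b - a)).+1.
  by rewrite -natr1 lerD2r truncn_le; lra.
exists (fun i => c (t i)); split.
- by rewrite /t addr0 min_l.
- by rewrite /t min_r// -lerBlDl; apply/ltW/truncnS_gt.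
- move=> i _; rewrite cd// /t -natr1.
  have [] := leP (a + i%:R) b; have [] := leP (a + (i%:R + 1)) b => h1 h2;
  by rewrite ler_norml; apply/andP; split; lra.
- by move=> i _; exact: cP.
Qed.

Section Slim.
Hypothesis cat0_X : cat0 X.

(** The path below has at most [8 T + 3] steps, hence at most [16 T], and the point found by
    recurrence lies within [T / 16] of [p]. It remains to show that this point is on [[x, m]]. *)
Lemma recurrent_slim g (N : R) x m c : 1 <= N -> recurrent 16 N g ->
  range g m -> geodesic_segment x m c ->
  N ^+ 2 + N + 3 <= mdist (ray_proj g x) m ->
  exists2 s, 0 <= s <= mdist x m &
    mdist (ray_proj g x) (c s) <= mdist (ray_proj g x) m / 10.
Proof.
move=> N1 gN gm gc; set p := ray_proj g x; set T := mdist p m => NT.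
have NN : 1 <= N ^+ 2 by exact: exprn_ege1.
have gp : range g p by exact: ray_proj_range.
pose P u := [\/ forall q, range g q -> mdist u p <= mdist u q,
  exists2 s : R, 0 <= s <= mdist x m & u = c s |
  exists2 v, forall q, range g q -> 3 * T <= mdist v q & mdist v u <= T].
(* The path climbs [x, p] to height [3 T] and descends along [x, m]; the crossing
   has length at most [T], so it cannot meet the [N]-neighbourhood of the ray. *)
suff [n nT [z [z0 zn zC1 zP]]] : exists2 n, n%:R <= 16 * T & linked P 1 n p m.
  have zC : steps 16 n z by move=> i /zC1; lra.
  have NT' : N <= mdist p m by rewrite -/T; lra.
  have [i [i_n [w gw wN]]] := gN _ _ gp gm NT' _ _ z0 zn zC nT.
  (* The threshold on [T] puts the point found by recurrence at distance more than [N] from [p]. On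
     [[x, p]] that is impossible, since there [p] is a nearest point of the ray. *)
  have TN : N < T / N.
    have N0 : 0 < N by lra.
    rewrite ltr_pdivlMr//.
    by rewrite -expr2; lra.
  rewrite -/T => /andP[/(lt_le_trans TN) {TN} lo hi].
  case: (zP i i_n) => [/(_ w gw)|[s hs zs]|[v vT vu]].
  - by move=> h; lra.
  - exists s => //; rewrite metric_sym -zs (le_trans hi)//.
    by rewrite ler_wpM2l ?mdist_ge0// lef_pV2 ?posrE//; lra.
  - by have := vT w gw; have := metric_triangle v (z i) w; lra.
have [b gb] := cat0_X.1 x p.
have onb s : 0 <= s <= mdist x p -> P (b s).
  by move=> hs; apply: Or31 => q gq; exact: (ray_proj_segment gb hs).
have onc s : 0 <= s <= mdist x m -> P (c s) by move=> hs; apply: Or32; exists s.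
have tr := metric_triangle x p m; rewrite -/T in tr.
have xp0 := mdist_ge0 x p; have xm0 := mdist_ge0 x m.
have [b0 b1 _] := gb; have [c0 c1 _] := gc.
have [small|big] := leP (mdist x p) (3 * T).
  have [n1 hn1 l1] := linked_segment gb (lexx 0) xp0 (lexx _) onb.
  have [n2 hn2 l2] := linked_segment gc (lexx 0) xm0 (lexx _) onc.
  rewrite b0 b1 in l1; rewrite c0 c1 in l2.
  exists (n1 + n2)%N; first by rewrite natrD; lra.
  exact: linked_cat (linked_sym l1) l2.
(* The crossing joins the points dividing [[x, p]] and [[x, m]] in the same ratio, the first at
   distance [3 T] from [p]; convexity bounds its length by [T]. *)
pose l := 3 * T / mdist x p.
have a0 : 0 < mdist x p by lra.
have l0 : 0 <= l by rewrite divr_ge0//; lra.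
have l1 : l <= 1 by rewrite ler_pdivrMr// mul1r ltW.
have lx : l * mdist x p = 3 * T by rewrite divfK ?gt_eqF.
have hl : 0 <= 1 - l <= 1 by apply/andP; split; lra.
have := cat0_convex cat0_X gb gc hl.
set xs := b _; set ms := c _ => xms.
have {xms} xms : mdist xs ms <= T.
  by rewrite (le_trans xms)// -/T ler_piMl//; lra.
have bs : 0 <= (1 - l) * mdist x p <= mdist x p.
  by rewrite mulrBl mul1r lx; apply/andP; split; lra.
have cs : 0 <= (1 - l) * mdist x m <= mdist x m.
  by rewrite mulr_ge0//= ?ler_piMl//; lra.
have /andP[bs0 bs1] := bs; have /andP[cs0 cs1] := cs.
have [n1 hn1 l1'] : exists2 n, n%:R <= mdist x p - (1 - l) * mdist x p + 1 &
    linked P 1 n xs (b (mdist x p)).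
  apply: (linked_segment gb bs0 bs1 (lexx _)) => s /andP[s0 s1].
  by apply: onb; rewrite (le_trans bs0).
have [n3 hn3 l3] : exists2 n, n%:R <= mdist x m - (1 - l) * mdist x m + 1 &
    linked P 1 n ms (c (mdist x m)).
  apply: (linked_segment gc cs0 cs1 (lexx _)) => s /andP[s0 s1].
  by apply: onc; rewrite (le_trans cs0).
have [e ge] := cat0_X.1 xs ms.
have [n2 hn2 l2] : exists2 n, n%:R <= mdist xs ms - 0 + 1 &
    linked P 1 n (e 0) (e (mdist xs ms)).
  apply: (linked_segment ge (lexx _) (mdist_ge0 _ _) (lexx _)) => s hs.
  apply: Or33; exists xs; last first.
    by rewrite (segment_dist ge hs).1; case/andP: hs => _ hs; lra.
  move=> q gq; rewrite (le_trans _ (ray_proj_segment gb bs gq))//.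
  by rewrite (segment_dist gb bs).2 mulrBl mul1r lx; lra.
case: ge => e0 e1 _; rewrite {}e0 {}e1 in l2.
rewrite c1 in l3; rewrite b1 in l1'.
exists (n1 + n2 + n3)%N.
  have lT : l * mdist x m <= 3 * T + T.
    apply: (@le_trans _ _ (l * (mdist x p + T))); first by rewrite ler_wpM2l.
    by rewrite mulrDr lx lerD2l ler_piMl//; lra.
  by rewrite !natrD; rewrite !mulrBl !mul1r lx in hn1 hn3; lra.
exact: linked_cat (linked_cat (linked_sym l1') l2) l3.
Qed.

Lemma recurrent_contracting g (N : R) : 1 <= N -> recurrent 16 N g ->
  contracting_with (2 * (N ^+ 2 + N + 3)) g.
Proof.
move=> N1 gN x y xy; rewrite ltNge; apply/negP => big.
set p := ray_proj g x in xy big; set q := ray_proj g y in big.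
have [a a0 pa] : exists2 a, 0 <= a & p = ray_at g a.
  by apply/range_rayP; exact: ray_proj_range.
have [b b0 qb] : exists2 b, 0 <= b & q = ray_at g b.
  by apply/range_rayP; exact: ray_proj_range.
pose m := ray_at g ((a + b) / 2).
have m0 : 0 <= (a + b) / 2 by lra.
have gm : range g m by exact: ray_at_range.
set S := N ^+ 2 + N + 3 in big.
have S5 : 5 <= S.
  have : 1 <= N ^+ 2 by exact: exprn_ege1.
  by rewrite /S; lra.
pose T := mdist p q / 2.
have pm : mdist p m = T.
  rewrite /T pa qb !ray_dist// -[in RHS](@gtr0_norm _ 2)// -normf_div.
  by congr `|_|; field.
have qm : mdist q m = T.
  rewrite /T pa qb !ray_dist// -[in RHS](@gtr0_norm _ 2)// -normf_div distrC.
  by congr `|_|; field.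
have ST : S <= T by rewrite /T ler_pdivlMr// mulrC.
have [c1 gc1] := cat0_X.1 m x; have [c2 gc2] := cat0_X.1 m y.
have [s hs] : exists2 s, 0 <= s <= mdist m x & mdist p (c1 s) <= T / 10.
  have [|s hs] := recurrent_slim N1 gN gm (segment_rev gc1);
    rewrite -/p pm// => ps.
  exists (mdist m x - s) => //.
  by case/andP: hs; rewrite (metric_sym x m) => ? ?; apply/andP; split; lra.
have [t ht] : exists2 t, 0 <= t <= mdist m y & mdist q (c2 t) <= T / 10.
  have [|s' hs'] := recurrent_slim N1 gN gm (segment_rev gc2);
    rewrite -/q qm// => ps.
  exists (mdist m y - s') => //.
  by case/andP: hs'; rewrite (metric_sym y m) => ? ?; apply/andP; split; lra.
move=> qt ps.
have [ms _] := segment_dist gc1 hs; have [mt _] := segment_dist gc2 ht.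
have s1 := mdist_triangle_rev m p (c1 s).
have t1 := mdist_triangle_rev m q (c2 t).
rewrite ms (metric_sym m) pm in s1; rewrite mt (metric_sym m) qm in t1.
have {s1} /andP[s1 s2] : - (T / 10) <= T - s <= T / 10.
  by rewrite -ler_norml (le_trans s1).
have {t1} /andP[t1 t2] : - (T / 10) <= T - t <= T / 10.
  by rewrite -ler_norml (le_trans t1).
have pq : mdist p q = 2 * T by rewrite /T; field.
(* The points of the two sides near [p] and [q] are nearly [2 T] apart, at distance at most
   [11 T / 10] from [m]. As 3.24 exceeds 2.42, the angle at [m] is obtuse. *)
have far : 18 / 10 * T <= mdist (c1 s) (c2 t).
  have := metric_triangle p (c1 s) q; have := metric_triangle (c1 s) (c2 t) q.
  rewrite (metric_sym (c2 t) q); lra.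
have /andP[_ hs1] := hs; have /andP[_ ht1] := ht.
suff : mdist m x <= mdist x y.
  by have := ray_proj_le x gm; rewrite -/p (metric_sym x m); lra.
apply: (cat0_obtuse cat0_X gc1 gc2 (s := s) (t := t)).
- by apply/andP; split; lra.
- by apply/andP; split; lra.
- apply: (@le_trans _ _ ((18 / 10 * T) ^+ 2)).
    apply: (@le_trans _ _ ((11 / 10 * T) ^+ 2 + (11 / 10 * T) ^+ 2)).
      by apply: lerD; rewrite ler_sqr ?nnegrE; lra.
    rewrite -subr_ge0 (_ : _ - _ = 82 / 100 * T ^+ 2); last by field.
    by rewrite mulr_ge0 ?sqr_ge0.
  by rewrite ler_sqr ?nnegrE; lra.
Qed.
End Slim.
End RecurrentContracting.
(** * Coarse inverses *)

Section CoarseInverse.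
Context {R : realType} {X Y : metricType R}.

(** A quasi-isometry with a quasi-inverse and common constants. The form is symmetric, so each
    result also applies to [g], and the lower bound for [f] follows from the upper bound for [g]. *)
Record coarse_inverse (K L : R) (f : X -> Y) (g : Y -> X) : Prop :=
  CoarseInverse {
    coarse_K : 1 <= K;
    coarse_L : 0 <= L;
    coarse_l : forall s t, mdist (f s) (f t) <= K * mdist s t + L;
    coarse_r : forall s t, mdist (g s) (g t) <= K * mdist s t + L;
    coarse_lr : forall x, mdist (g (f x)) x <= L;
    coarse_rl : forall y, mdist (f (g y)) y <= L }.

(** A bound on the Hausdorff distance between the image of [a] and [b], independent of
    parametrizations. *)
Definition fellow (E : R) (f : X -> Y) (a : ray X) (b : ray Y) : Prop :=
  (forall u, range a u -> exists2 v, range b v & mdist (f u) v <= E) /\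
  (forall v, range b v -> exists2 u, range a u & mdist (f u) v <= E).

Lemma coarse_lower K L f g s t : coarse_inverse K L f g ->
  mdist s t <= K * mdist (f s) (f t) + 3 * L.
Proof.
move=> fg; have := coarse_r fg (f s) (f t).
have := coarse_lr fg s; have := coarse_lr fg t.
have := metric_triangle s (g (f s)) t.
have := metric_triangle (g (f s)) (g (f t)) t.
by rewrite (metric_sym s (g (f s))); lra.
Qed.

(** A chain between points of [b] is pulled back by [g]; recurrence of [a] picks an index, and [f]
    carries its properties over to [b]. [C] is fixed before [N], because [contracting_recurrent]
    produces [N] from [C]. *)
Lemma recurrent_transfer (K L E C' : R) :
  1 <= K -> 0 <= L -> 0 <= E -> 1 <= C' ->
  exists2 C, 1 <= C & forall N, 1 <= N -> exists2 N', 1 <= N' &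
    forall f g a b, coarse_inverse K L f g -> fellow E f a b ->
      recurrent C N a -> recurrent C' N' b.
Proof.
move=> K1 L0 E0 C1; have K0 : 0 <= K by lra.
have C0 : 0 <= C' by lra.
pose E1 := K * E + 2 * L.
have KE0 : 0 <= K * E by rewrite mulr_ge0.
have E10 : 0 <= E1 by rewrite /E1; lra.
have KC0 : 0 <= K * C' by rewrite mulr_ge0.
have KKC0 : 0 <= 4 * K * (K * C') by rewrite !mulr_ge0.
(* The summands serve the length ratio, the upper fraction and the jumps, in this order. *)
pose C := 2 * K * C' + 4 * K * (K * C') + (2 * E1 + (K * C' + L)) + 1.
have C_ge1 : 1 <= C by rewrite /C; lra.
exists C => // N N1; have N0 : 0 <= N by lra.
pose F := L + (K * E1 + L).
have KE1 : 0 <= K * E1 by rewrite mulr_ge0.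
have F0 : 0 <= F by rewrite /F; lra.
pose G := 3 * L + K * (F + E).
have KF0 : 0 <= K * (F + E) by rewrite mulr_ge0//; lra.
have G0 : 0 <= G by rewrite /G; lra.
have KN0 : 0 <= K * N by rewrite mulr_ge0.
have KKN0 : 0 <= 4 * K * (K * N) by rewrite !mulr_ge0.
have KNG0 : 0 <= 2 * K * (N * G) by rewrite !mulr_ge0.
pose H := F + E + L.
have CH0 : 0 <= C' * H by rewrite mulr_ge0// /H; lra.
(* Each summand absorbs one error term met below, mostly through [N' <= l']. *)
pose N' := 4 * K * (K * N) + 2 * (K * N) + (2 * E + 5 * L + 2 * E) +
  (F + (K * N + L) + E) + 2 * (C' * H) + 2 * (2 * K * (N * G)) + 1.
exists N'; first by rewrite /N'; lra.
move=> f g a b fg [ab ba] aN p' q' bp bq lN n z' z0 zn zC nC.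
have [p ap pp] := ba _ bp; have [q aq qq] := ba _ bq.
set l' := mdist p' q' in lN nC *; pose l := mdist p q.
have l'0 : 0 <= l' by exact: mdist_ge0.
have l0 : 0 <= l by exact: mdist_ge0.
have l'l : l' <= 2 * (K * l).
  have := coarse_l fg p q; rewrite -/l.
  have := metric_triangle p' (f p) q'; have := metric_triangle (f p) (f q) q'.
  rewrite (metric_sym p' (f p)) -/l'; move: lN; rewrite /N'; lra.
have ll' : l <= 2 * (K * l').
  have := coarse_lower p q fg; rewrite -/l => h.
  have : mdist (f p) (f q) <= l' + 2 * E.
    have := metric_triangle (f p) p' (f q); have := metric_triangle p' q' (f q).
    by rewrite (metric_sym q' (f q)) -/l'; lra.
  move/(ler_wpM2l K0); rewrite mulrDr => h2.
  have h3 : K * (2 * E + 3 * L) <= K * l'.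
    by apply: ler_wpM2l => //; move: lN; rewrite /N'; lra.
  have h4 : 3 * L <= K * (3 * L) by rewrite ler_peMl// mulr_ge0.
  by rewrite mulrDr in h3; lra.
have n0 : n != 0%N.
  apply/eqP => n0; move: lN; rewrite /l' -z0 -zn n0 mdistxx /N'; lra.
(* The ends are replaced by points of [a], as recurrence requires; since [n] is nonzero the two
   replacements do not clash. *)
pose z i := if i == 0%N then p else if i == n then q else g (z' i).
have zg i : mdist (z i) (g (z' i)) <= E1.
  have end_near u u' : mdist (f u) u' <= E -> mdist u (g u') <= E1.
    move=> uu'; have := coarse_lr fg u; have := coarse_r fg (f u) u'.
    have := metric_triangle u (g (f u)) (g u').
    have := ler_wpM2l K0 uu'; rewrite (metric_sym u (g (f u))) /E1; lra.
  rewrite /z; case: eqVneq => [->|i0]; first by rewrite z0 end_near.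
  case: eqVneq => [->|i_n]; first by rewrite zn end_near.
  by rewrite mdistxx.
have zf i : mdist (z' i) (f (z i)) <= F.
  have := metric_triangle (z' i) (f (g (z' i))) (f (z i)).
  have := coarse_l fg (g (z' i)) (z i); have := ler_wpM2l K0 (zg i).
  have := coarse_rl fg (z' i).
  by rewrite (metric_sym (z' i) (f (g _))) (metric_sym (g _) (z i)) /F; lra.
have zC' : steps C n z.
  move=> i i_n; have := metric_triangle (z i) (g (z' i)) (z i.+1).
  have := metric_triangle (g (z' i)) (g (z' i.+1)) (z i.+1).
  have := zg i; have := zg i.+1; rewrite (metric_sym (z i.+1)).
  have := coarse_r fg (z' i) (z' i.+1); have := ler_wpM2l K0 (zC _ i_n).
  by rewrite /C; lra.
have zn' : z n = q by rewrite /z (negbTE n0) eqxx.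
have Nl : N <= l.
  have K20 : 0 < 2 * K by lra.
  rewrite -(ler_pM2l K20); move: lN; rewrite /N'; lra.
have nC' : n%:R <= C * l.
  rewrite (le_trans nC)// (le_trans (ler_wpM2l C0 l'l))//.
  rewrite (_ : C' * _ = 2 * K * C' * l); last by ring.
  by rewrite ler_wpM2r// /C; lra.
have [i [i_n [w aw wN] /andP[lo hi]]] := aN _ _ ap aq Nl n z erefl zn' zC' nC'.
exists i; split=> //.
  have [w' bw' ww'] := ab _ aw; exists w' => //.
  have := metric_triangle (z' i) (f (z i)) w'.
  have := metric_triangle (f (z i)) (f w) w'.
  have := coarse_l fg (z i) w; have := ler_wpM2l K0 wN; have := zf i.
  by rewrite /N'; lra.
have zi0 := mdist_ge0 (z i) p; have zi0' := mdist_ge0 (z' i) p'.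
rewrite -/l in lo hi; rewrite -/l'; apply/andP; split.
  rewrite ler_pdivrMr; last by rewrite /N'; lra.
  rewrite ler_pdivrMr in lo; last by lra.
  have d1 : mdist (z i) p <= K * mdist (z' i) p' + G.
    have := coarse_lower (z i) p fg.
    have : mdist (f (z i)) (f p) <= F + E + mdist (z' i) p'.
      have := zf i; have := metric_triangle (f (z i)) (z' i) (f p).
      have := metric_triangle (z' i) p' (f p).
      by rewrite (metric_sym p' (f p)) (metric_sym (f (z i)) (z' i)); lra.
    by move/(ler_wpM2l K0); rewrite /G mulrDr; lra.
  have d2 := ler_wpM2r N0 d1.
  have d3 : K * l <= K * (mdist (z' i) p' * (K * N) + N * G).
    by apply: ler_wpM2l => //; rewrite (le_trans lo)// (le_trans d2)//; lra.
  have d4 :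
      2 * (K * l) <= mdist (z' i) p' * (2 * K * (K * N)) + 2 * K * (N * G).
    by rewrite mulrDr in d3; lra.
  have d5 : l' <= mdist (z' i) p' * (4 * K * (K * N)).
    by move: lN; rewrite /N'; lra.
  apply: (le_trans d5); apply: ler_wpM2l => //.
  by rewrite /N'; lra.
rewrite ler_pdivlMr in hi; last by lra.
rewrite ler_pdivlMr; last by lra.
have d1 : mdist (z' i) p' <= H + K * mdist (z i) p.
  have := coarse_l fg (z i) p; have := zf i.
  have := metric_triangle (z' i) (f (z i)) p'.
  have := metric_triangle (f (z i)) (f p) p'.
  by rewrite /H; lra.
have d2 := ler_wpM2r C0 d1.
have d3 : 4 * K * (K * C') * mdist (z i) p <= 2 * (K * l').
  rewrite (le_trans _ ll')// (le_trans _ hi)// [leRHS]mulrC ler_wpM2r//.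
  by rewrite /C; lra.
have d4 : 2 * (K * C') * mdist (z i) p <= l'.
  have K20 : 0 < 2 * K by lra.
  by rewrite -(ler_pM2l K20); lra.
by move: lN; rewrite /N'; lra.
Qed.

End CoarseInverse.

Lemma coarse_inverse_sym (R : realType) (X Y : metricType R) (K L : R)
  (f : X -> Y) (g : Y -> X) : coarse_inverse K L f g -> coarse_inverse K L g f.
Proof. by case. Qed.
(** * Stability of quasi-geodesics and image rays *)

Section Stability.
Context {R : realType}.

(** The Morse property. During a high excursion of [k] steps the projection drifts by at most
    [D (k / M + 3)], whereas a quasi-geodesic makes linear progress; for large [M] this bounds [k],
    hence the height. *)
Lemma contracting_stable (X : metricType R) (D C B : R) : 1 <= C ->
  exists2 E, 0 <= E & forall (g : ray X) n z, contracting_with D g ->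
    steps C n z ->
    (forall i j, (i <= j <= n)%N ->
      (j - i)%:R <= C * mdist (z i) (z j) + C) ->
    height g (z 0%N) <= B -> height g (z n) <= B ->
    forall i, (i <= n)%N -> height g (z i) <= E.
Proof.
move=> C1; have C0 : 0 <= C by lra.
wlog D0 : D / 0 <= D.
  move=> /(_ (Num.max D 0)); rewrite le_max lexx orbT => /(_ isT)[E E0 HE].
  exists E => // g n z gD; apply: HE; apply: contracting_with_le gD.
  by rewrite le_max lexx.
(* The first term lets half of [k] absorb the drift; the second makes the two ends low. *)
pose M := (Num.truncn (2 * C * D + `|B|)).+1.
have HM : 2 * C * D + `|B| <= M%:R by apply/ltW/truncnS_gt.
have CD0 : 0 <= 2 * C * D by rewrite !mulr_ge0.
have M0 : 0 < M%:R :> R by rewrite ltr0n.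
have HB := ler_norm B.
pose N0 := C * M%:R; have MN0 : M%:R <= N0 by rewrite ler_peMl// ltW.
pose k0 := 2 * C * (2 * N0 + 3 * D + 1).
have k00 : 0 <= k0 by rewrite !mulr_ge0//; lra.
exists (C * k0 + N0); first by rewrite addr_ge0 ?mulr_ge0//; lra.
move=> g n z gD zC zlow h0 hn i i_n.
have [low|high] := leP (height g (z i)) N0.
  by rewrite (le_trans low)// lerDr mulr_ge0.
pose P j := height g (z j) <= N0.
have P0 : P 0%N by rewrite /P; have := normr_ge0 B; lra.
have Pn : P n by rewrite /P; have := normr_ge0 B; lra.
have [i0 [/andP[_ i0i] low0 last0]] := last_true P0 (leq0n i).
have [i1 [/andP[ii1 i1n] low1 first1]] := first_true Pn i_n.
have ltn_high j : P j -> j != i by apply: contraTneq => ->; rewrite /P -ltNge.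
have {}i0i : (i0 < i)%N by rewrite ltn_neqAle i0i ltn_high.
have {}ii1 : (i < i1)%N by rewrite ltn_neqAle ii1 eq_sym ltn_high.
have i01 : (i0 <= i1)%N := ltnW (ltn_trans i0i ii1).
have drift : mdist (ray_proj g (z i0)) (ray_proj g (z i1)) <=
    D * ((i1 - i0)%:R / M%:R + 3).
  have /= := @excursion_drift R X g C D M gD C0 D0 isT (i1 - i0)
    (fun i => z (i0 + i)%N).
  rewrite addn0 subnKC//; apply.
  - by rewrite ltn_subRL addn1 (leq_trans _ ii1).
  - by apply: (steps_sub (leq_sub2r _ i1n)); exact: steps_shift.
  - move=> j /andP[j0 ji]; rewrite ltNge.
    have [ij|ij] := leqP i (i0 + j).
      by apply: first1; rewrite ij -ltn_subRL.
    by apply: last0; rewrite (ltnW ij) andbT -addn1 leq_add2l.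
set k := (i1 - i0)%:R in drift.
have k_ge0 : 0 <= k by exact: ler0n.
have kM : 2 * (C * (D * (k / M%:R))) <= k.
  rewrite !mulrA ler_pdivrMr// [leRHS]mulrC ler_wpM2r//.
  by have := normr_ge0 B; lra.
have kd : k <= C * mdist (z i0) (z i1) + C by apply: zlow; rewrite i01.
have d01 : mdist (z i0) (z i1) <= 2 * N0 + D * (k / M%:R) + 3 * D.
  have := metric_triangle (z i0) (ray_proj g (z i0)) (z i1).
  have := metric_triangle (ray_proj g (z i0)) (ray_proj g (z i1)) (z i1).
  rewrite (metric_sym (ray_proj g (z i1)) (z i1)) -!/(height g _).
  by move: low0 low1; rewrite /P mulrDr in drift *; lra.
have kk0 : k <= k0.
  by have := ler_wpM2l C0 d01; rewrite !mulrDr /k0; lra.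
have zi : mdist (z i0) (z i) <= C * k0.
  rewrite (le_trans (steps_dist zC _))//; first by rewrite (ltnW i0i).
  rewrite ler_wpM2l// (le_trans _ kk0)// ler_nat.
  by rewrite leq_sub2r// ltnW.
rewrite (le_trans (ray_proj_le _ (ray_proj_range g (z i0))))//.
rewrite (le_trans (metric_triangle _ (z i0) _))// lerD//.
by rewrite metric_sym.
Qed.

(** A discrete intermediate value argument: take the first index whose projection time reaches [s].
    Projection times move by at most [2 E + C] in one step. If none reaches [s], the last point of
    the chain will do. *)
Lemma chain_cover (X : metricType R) (g : ray X) (C B E m s : R) n z :
  0 <= C -> 0 <= B -> steps C n z ->
  (forall i, (i <= n)%N -> height g (z i) <= E) ->
  mdist (z 0%N) (origin g) <= B -> mdist (z n) (ray_at g m) <= B ->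
  0 <= s <= m ->
  exists2 i, (i <= n)%N & mdist (z i) (ray_at g s) <= 3 * E + C + B.
Proof.
move=> C0 B0 zC zE z0 zn /andP[s0 sm].
have E0 : 0 <= E by apply: le_trans (zE 0%N isT); exact: mdist_ge0.
have /choice[t ht] :
    forall i, exists t, 0 <= t /\ ray_proj g (z i) = ray_at g t.
  by move=> i; have /range_rayP[t t0 pt] := ray_proj_range g (z i); exists t.
have near i u : (i <= n)%N -> 0 <= u ->
    mdist (z i) (ray_at g u) <= E + `|t i - u|.
  move=> i_n u0; have [ti0 pi] := ht i; rewrite -(ray_dist g)// -pi.
  by rewrite (le_trans (metric_triangle _ (ray_proj g (z i)) _))// lerD2r zE.
have close i j : (i <= n)%N -> 0 <= j ->
    `|t i - j| <= E + mdist (z i) (ray_at g j).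
  move=> i_n j0; have [ti0 pi] := ht i; rewrite -(ray_dist g)// -pi.
  rewrite (le_trans (metric_triangle _ (z i) _))// lerD2r metric_sym.
  exact: zE.
have m0 : 0 <= m by lra.
have [stn|tns] := leP s (t n); last first.
  exists n => //; rewrite (le_trans (near _ _ _ s0))//.
  have := close _ _ (leqnn n) m0; rewrite ler_norml => /andP[c1 c2].
  have : `|t n - s| <= E + B by rewrite ler_norml; apply/andP; split; lra.
  by lra.
have [i [/andP[_ i_n] sti firsti]] :=
  @first_true (fun i => s <= t i) 0%N n stn isT.
exists i => //; rewrite (le_trans (near _ _ _ s0))//.
case: i => [|i] in i_n sti firsti *.
  have := close _ _ i_n (lexx 0); rewrite ray_at0 subr0 => c.
  have := le_trans (ler_norm _) c; rewrite ger0_norm ?subr_ge0//; lra.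
have := firsti i; rewrite ltnSn -ltNge => /(_ isT) tis.
have [ti0 pi] := ht i.
have := close _ _ i_n ti0; rewrite -pi.
have := metric_triangle (z i.+1) (z i) (ray_proj g (z i)).
rewrite (metric_sym (z i.+1) (z i)); have := zC _ i_n; have := zE _ (ltnW i_n).
rewrite /height !ger0_norm ?subr_ge0//; last by rewrite ltW// (lt_le_trans tis).
by lra.
Qed.

Context {X Y : metricType R}.

(** The geodesic, sampled at unit steps and pulled back by [g], is a quasi-geodesic chain with ends
    near [a]. Stability and covering apply to it, and [f] carries both estimates to [Y]. *)
Lemma segment_fellow (K L D B : R) : 1 <= K -> 0 <= L -> 0 <= B ->
  exists2 E, 0 <= E & forall (f : X -> Y) g a y0 m c, coarse_inverse K L f g ->
    contracting_with D a -> mdist (f (origin a)) y0 <= B -> 0 <= m ->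
    geodesic_segment y0 (f (ray_at a m)) c ->
    (forall s, 0 <= s <= mdist y0 (f (ray_at a m)) ->
      exists2 u, range a u & mdist (f u) (c s) <= E) /\
    (forall t, 0 <= t <= m ->
      exists2 s, 0 <= s <= mdist y0 (f (ray_at a m)) &
        mdist (f (ray_at a t)) (c s) <= E).
Proof.
move=> K1 L0 B0; have K0 : 0 <= K by lra.
pose C := K + 3 * L + 1; have C1 : 1 <= C by rewrite /C; lra.
pose B' := K * B + 2 * L; have KB0 : 0 <= K * B by rewrite mulr_ge0.
have B'0 : 0 <= B' by rewrite /B'; lra.
have [E1 E10 stable] := @contracting_stable X D C B' C1.
pose E2 := 3 * E1 + C + B'; have E20 : 0 <= E2 by rewrite /E2; lra.
have E12 : E1 <= E2 by rewrite /E2; lra.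
exists (K * E2 + 2 * L + 1) => [|f g a y0 m c fg aD ay m0].
  by have := mulr_ge0 K0 E20; lra.
set l := mdist y0 _ => gc; have l0 : 0 <= l by exact: mdist_ge0.
have [c0 cl cd] := gc; rewrite -/l in cl cd.
pose t (i : nat) := Num.min (i%:R : R) l.
pose z i := g (c (t i)); pose n := (Num.truncn l).+1.
have ht i : 0 <= t i <= l by rewrite /t le_min ler0n l0 ge_min lexx orbT.
have tn : t n = l by rewrite /t min_r//; apply/ltW/truncnS_gt.
have n_l : n%:R <= l + 1 by rewrite /n -natr1 lerD2r truncn_le.
have zC : steps C n z.
  move=> i _; rewrite (le_trans (coarse_r fg _ _))// cd//.
  have : `|t i - t i.+1| <= 1.
    rewrite /t -natr1.
    have [] := leP (i%:R : R) l; have [] := leP (i%:R + 1) l => h1 h2;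
    by rewrite ler_norml; apply/andP; split; lra.
  by move=> /(ler_wpM2l K0); rewrite /C; lra.
have zlow i j : (i <= j <= n)%N -> (j - i)%:R <= C * mdist (z i) (z j) + C.
  move=> /andP[ij jn].
  have := coarse_lower (c (t i)) (c (t j)) (coarse_inverse_sym fg).
  rewrite cd// -!/(z _) natrB//.
  have jl : j%:R <= l + 1 by rewrite (le_trans _ n_l)// ler_nat.
  have ij' : i%:R <= j%:R :> R by rewrite ler_nat.
  (* Clipping the samples at [l] loses at most one unit. *)
  have : j%:R - i%:R - 1 <= `|t i - t j|.
    rewrite distrC (le_trans _ (ler_norm _))// /t.
    have [] := leP (i%:R : R) l; have [] := leP (j%:R : R) l => h1 h2; lra.
  have : K * mdist (z i) (z j) <= C * mdist (z i) (z j).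
    by rewrite ler_wpM2r ?mdist_ge0// /C; lra.
  by rewrite /C; lra.
have z0 : mdist (z 0%N) (origin a) <= B'.
  rewrite /z /t min_l// c0; have := coarse_lr fg (origin a).
  have := coarse_r fg y0 (f (origin a)); rewrite (metric_sym y0 (f _)).
  have := metric_triangle (g y0) (g (f (origin a))) (origin a).
  by have := ler_wpM2l K0 ay; rewrite /B'; lra.
have zn : mdist (z n) (ray_at a m) <= B'.
  by rewrite /z tn cl (le_trans (coarse_lr fg _))// /B'; lra.
have low u v : range a v -> mdist u v <= B' -> height a u <= B'.
  by move=> av; apply: le_trans; exact: ray_proj_le.
have h0 : height a (z 0%N) <= B'.
  by apply: low z0; rewrite -ray_at0; exact: ray_at_range.
have hn : height a (z n) <= B' by apply: low zn; exact: ray_at_range.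
have zE := stable _ _ _ aD zC zlow h0 hn.
have fz i u : mdist (z i) u <= E2 -> mdist (f u) (c (t i)) <= K * E2 + 2 * L.
  move=> zu; have := coarse_l fg u (z i); have := coarse_rl fg (c (t i)).
  have := metric_triangle (f u) (f (z i)) (c (t i)).
  by have := ler_wpM2l K0 zu; rewrite (metric_sym u (z i)); lra.
split=> [s /andP[s0 sl]|s hs].
  pose i := Num.truncn s.
  have i_n : (i <= n)%N by rewrite leqW// le_truncn.
  have lo : i%:R <= s by rewrite truncn_le.
  have hi : s < i%:R + 1 by rewrite natr1 truncnS_gt.
  exists (ray_proj a (z i)); first exact: ray_proj_range.
  have := fz i _ (le_trans (zE _ i_n) E12).
  have := metric_triangle (f (ray_proj a (z i))) (c (t i)) (c s).
  rewrite cd ?s0//.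
  have : `|t i - s| <= 1.
    rewrite /t min_l; last by lra.
    by rewrite ler_norml; apply/andP; split; lra.
  by lra.
have CC0 : 0 <= C by lra.
have [i i_n zi] := chain_cover CC0 B'0 zC zE z0 zn hs.
by exists (t i) => //; rewrite (le_trans (fz _ _ zi))// lerDl.
Qed.

End Stability.

(** * Limits of geodesics and image rays *)

Section ImageRay.
Context {R : realType}.

Lemma complete_cauchy_seq (X : metricType R) (u : nat -> X) :
  complete_space X ->
  (forall e, 0 < e -> exists m0, forall m m', (m0 <= m)%N -> (m0 <= m')%N ->
     mdist (u m) (u m') < e) ->
  exists l, forall e, 0 < e -> exists m0, forall m, (m0 <= m)%N ->
    mdist (u m) l < e.
Proof.
move=> cX cu; have cF : cauchy (u @ \oo).
  apply/cauchy_exP => e e0; have [m0 hm] := cu e e0; exists (u m0).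
  by exists m0 => // m /= m0m; rewrite ballEmdist /=; exact: hm.
have [l ul] := cX _ _ cF; exists l => e e0.
have [m0 _ hm] : (u @ \oo) (ball l e) by apply: ul; exact: nbhsx_ballx.
exists m0 => m m0m; have := hm m m0m; rewrite /= ballEmdist /=.
by rewrite metric_sym.
Qed.

Lemma norm_le_all_eq0 (x : R) : (forall e, 0 < e -> `|x| <= e) -> x = 0.
Proof.
move=> xe; apply/eqP; rewrite -normr_le0; apply/ler_addgt0Pr => e e0.
by rewrite add0r xe.
Qed.

Context {X Y : metricType R}.
Hypotheses (complete_Y : complete_space Y) (cat0_Y : cat0 Y).

(** Convexity compares [c] with the initial part of [c'] ending at [c' s]. One [E] is the gap at the
    ends, the other the difference of their lengths, and both shrink by the factor
    [t / mdist y0 w]. *)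
Lemma geodesic_divergence (y0 w w' : Y) c c' (s t E : R) :
  geodesic_segment y0 w c -> geodesic_segment y0 w' c' ->
  0 <= s <= mdist y0 w' -> mdist w (c' s) <= E ->
  0 <= t <= mdist y0 w -> t <= mdist y0 w' -> 0 < mdist y0 w ->
  mdist (c t) (c' t) <= 2 * E * t / mdist y0 w.
Proof.
move=> gc gc' hs ws ht tw' w0; have /andP[s0 s1] := hs; have /andP[t0 t1] := ht.
pose l := t / mdist y0 w; have tl : t = l * mdist y0 w by rewrite divfK ?gt_eqF.
have l0 : 0 <= l by rewrite divr_ge0 ?mdist_ge0.
have l1 : l <= 1 by rewrite ler_pdivrMr// mul1r.
have hl : 0 <= l <= 1 by rewrite l0.
have := cat0_convex cat0_Y gc (segment_prefix gc' hs) hl.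
have [cs _] := segment_dist gc' hs; rewrite cs -tl => h.
have := mdist_triangle_rev y0 w (c' s); rewrite cs => h'.
have [_ _ cd'] := gc'.
have ls : 0 <= l * s <= mdist y0 w'.
  by rewrite mulr_ge0//= (le_trans _ s1)// ler_piMl.
have h2 : mdist (c' (l * s)) (c' t) <= l * E.
  rewrite cd' ?t0// tl -mulrBr normrM (ger0_norm l0) ler_wpM2l// distrC.
  exact: le_trans h' ws.
rewrite (le_trans (metric_triangle _ (c' (l * s)) _))//.
have := ler_wpM2l l0 ws.
rewrite (_ : 2 * E * t / _ = l * E + l * E); last first.
  by rewrite /l; field; rewrite gt_eqF.
by lra.
Qed.

Lemma fellow_ray (K L D B : R) : 1 <= K -> 0 <= L -> 0 <= B ->
  exists2 E, 0 <= E & forall (f : X -> Y) g a y0, coarse_inverse K L f g ->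
    contracting_with D a -> mdist (f (origin a)) y0 <= B ->
    exists2 b, origin b = y0 & fellow E f a b.
Proof.
move=> K1 L0 B0; have [E E0 HE] := @segment_fellow R X Y K L D B K1 L0 B0.
exists (E + 1) => [|f g a y0 fg aD ay]; first by lra.
pose w (m : nat) := f (ray_at a m%:R); pose l m := mdist y0 (w m).
have /choice[c gc] : forall m, exists c, geodesic_segment y0 (w m) c.
  by move=> m; exact: cat0_Y.1.
have big A : exists m0, forall m, (m0 <= m)%N -> A <= l m.
  exists (Num.truncn (K * (`|A| + B) + 3 * L)).+1 => m hm.
  have := coarse_lower (origin a) (ray_at a m%:R) fg.
  rewrite -{1}ray_at0 ray_dist// sub0r normrN ger0_norm// -/(w m).
  have : K * (`|A| + B) + 3 * L < m%:R.
    by rewrite (lt_le_trans (truncnS_gt _))// ler_nat.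
  move=> h1 h2; have : K * (`|A| + B) < K * mdist (f (origin a)) (w m) by lra.
  rewrite ltr_pM2l; last by lra.
  have := metric_triangle (f (origin a)) y0 (w m); rewrite -/(l m).
  by have := ler_norm A; lra.
have fel m := HE f g a y0 m%:R (c m) fg aD ay (ler0n _ _) (gc m).
(* The end of [c m] is within [E] of the later geodesic [c m'], as [geodesic_divergence]
   requires. *)
have div m m' t : (m <= m')%N -> 0 < l m -> 0 <= t <= l m -> t <= l m' ->
    mdist (c m t) (c m' t) <= 2 * E * t / l m.
  move=> mm' lm tm tm'; have [_ /(_ m%:R)] := fel m'.
  rewrite ler0n ler_nat => /(_ mm')[s hs ws].
  exact: geodesic_divergence (gc m) (gc m') hs ws tm tm' lm.
(* The guard [0 <= t] lets the choice range over all reals, with default [y0] at negative times. *)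
have /choice[b hb] : forall t, exists bt, 0 <= t -> forall e, 0 < e ->
    exists m0, forall m, (m0 <= m)%N -> mdist (c m t) bt < e.
  move=> t; have [t0|] := leP 0 t; last by exists y0.
  have [|bt hbt] := @complete_cauchy_seq Y (fun m => c m t) complete_Y.
    move=> e e0; have [m0 hm0] := big (t + 2 * E * t / (e / 2) + 1).
    have e2 : 0 < e / 2 by lra.
    have Ee : 0 <= 2 * E * t / (e / 2) by rewrite divr_ge0 ?mulr_ge0// ltW.
    have qE : 2 * E * t = 2 * E * t / (e / 2) * (e / 2).
      by rewrite divfK ?gt_eqF.
    move: (2 * E * t / (e / 2)) Ee qE hm0 => q q0 qE hm0.
    exists m0.
    have suffm m m' : (m0 <= m)%N -> (m <= m')%N -> mdist (c m t) (c m' t) < e.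
      move=> h h'; have lm := hm0 _ h; have lm' := hm0 _ (leq_trans h h').
      have lm0 : 0 < l m by lra.
      apply: (@le_lt_trans _ _ (e / 2)); last by lra.
      rewrite (le_trans (div _ _ _ h' lm0 _ _))//;
        [by apply/andP; split; lra|lra|].
      by rewrite ler_pdivrMr// qE mulrC ler_pM2l//; lra.
    move=> m m' h h'; have [mm|mm] := leqP m m'; first exact: suffm.
    by rewrite metric_sym suffm// ltnW.
  by exists bt.
have close m t : 0 < l m -> 0 <= t <= l m ->
    mdist (c m t) (b t) <= 2 * E * t / l m.
  move=> lm tm; apply/ler_addgt0Pr => e e0; have /andP[t0 t1] := tm.
  have [m1 h1] := hb t t0 e e0; have [m2 h2] := big t.
  pose m' := maxn m (maxn m1 m2).
  have /h1 hm1 : (m1 <= m')%N by rewrite !leq_max leqnn orbT.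
  have /h2 hm2 : (m2 <= m')%N by rewrite !leq_max leqnn !orbT.
  have := div m m' t (leq_maxl _ _) lm tm hm2.
  by have := metric_triangle (c m t) (c m' t) (b t); lra.
have bd (s t : {nonneg R}) : mdist (b s%:num) (b t%:num) = `|s%:num - t%:num|.
  apply/eqP; rewrite -subr_eq0; apply/eqP/norm_le_all_eq0 => e e0.
  have e2 : 0 < e / 2 by lra.
  have [m1 h1] := hb _ (ge0 s) _ e2; have [m2 h2] := hb _ (ge0 t) _ e2.
  have [m3 h3] := big s%:num; have [m4 h4] := big t%:num.
  pose m := maxn (maxn m1 m2) (maxn m3 m4).
  have /h1 hm1 : (m1 <= m)%N by rewrite !leq_max leqnn.
  have /h2 hm2 : (m2 <= m)%N by rewrite !leq_max leqnn orbT.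
  have /h3 hm3 : (m3 <= m)%N by rewrite !leq_max leqnn !orbT.
  have /h4 hm4 : (m4 <= m)%N by rewrite !leq_max leqnn !orbT.
  have [_ _ cd] := gc m.
  have <- := cd s%:num t%:num; rewrite ?hm3 ?hm4 ?ge0//.
  have q1 := metric_triangle (b s%:num) (c m s%:num) (b t%:num).
  have q2 := metric_triangle (c m s%:num) (c m t%:num) (b t%:num).
  have q3 := metric_triangle (c m s%:num) (b s%:num) (c m t%:num).
  have q4 := metric_triangle (b s%:num) (b t%:num) (c m t%:num).
  rewrite (metric_sym (b s%:num) (c m s%:num)) in q1.
  rewrite (metric_sym (b t%:num) (c m t%:num)) in q4.
  by rewrite ler_norml; apply/andP; split; lra.
pose r := @Ray R Y (fun t => b t%:num) bd.
have rE t : 0 <= t -> ray_at r t = b t.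
    by move=> t0; rewrite /ray_at /= ger0_norm.
have unit m t : 0 <= t -> t + 2 * E * t + 1 <= l m -> mdist (c m t) (b t) <= 1.
  move=> t0 tm; have Et : 0 <= 2 * E * t by rewrite !mulr_ge0.
  have lm : 0 < l m by lra.
  rewrite (le_trans (close _ _ lm _))//; first by apply/andP; split; lra.
  by rewrite ler_pdivrMr//; lra.
exists r.
  apply/mdist_positivity/norm_le_all_eq0 => e e0; rewrite -ray_at0 rE//.
  have [m0 h0] := hb 0 (lexx 0) e e0.
  by have [<- _ _] := gc m0; rewrite metric_sym ger0_norm ?mdist_ge0// ltW// h0.
split=> [u /range_rayP[t t0 ->]|v /range_rayP[t t0 ->]].
  (* For every [m], the point of [c m] near [f (ray_at a t)] has parameter at most [S], so [m] can
     be chosen after [S]. *)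
  pose S := mdist y0 (f (ray_at a t)) + E.
  have S0 : 0 <= S by rewrite addr_ge0 ?mdist_ge0.
  have [m1 h1] := big (S + 2 * E * S + 1).
  pose m := maxn m1 (Num.truncn t).+1.
  have lm : S + 2 * E * S + 1 <= l m by rewrite h1// leq_maxl.
  have tm : t <= m%:R.
    by rewrite (le_trans (ltW (truncnS_gt t)))// ler_nat leq_maxr.
  have [_ /(_ t)] := fel m; rewrite t0 tm => /(_ isT)[s hs fs].
  have [ys _] := segment_dist (gc m) hs; have /andP[s0 _] := hs.
  have sS : s <= S.
    by have := metric_triangle y0 (f (ray_at a t)) (c m s); rewrite ys /S; lra.
  exists (ray_at r s); first exact: ray_at_range.
  rewrite rE// (le_trans (metric_triangle _ (c m s) _))// lerD// unit//.
  rewrite (le_trans _ lm)// lerD2r lerD// ler_wpM2l// mulr_ge0//.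
have [m hm] := big (t + 2 * E * t + 1).
have Et : 0 <= 2 * E * t by rewrite !mulr_ge0.
have lm := hm _ (leqnn m).
have [/(_ t) + _] := fel m; rewrite -/(w m) -/(l m) => ht.
have [|u au fu] := ht; first by apply/andP; split; lra.
exists u => //; rewrite rE//.
by rewrite (le_trans (metric_triangle _ (c m t) _))// lerD// unit.
Qed.

(** Contraction passes to recurrence of [a], then of [b], and back. The constant 16 demanded by
    [recurrent_contracting] determines [C], then [N], then [N'], so [D'] is the same for all
    rays. *)
Lemma image_ray (K L D B : R) : 1 <= K -> 0 <= L -> 0 <= B ->
  exists E D', 0 <= E /\ forall (f : X -> Y) g a y0, coarse_inverse K L f g ->
    contracting_with D a -> mdist (f (origin a)) y0 <= B ->
    exists b, [/\ origin b = y0, fellow E f a b & contracting_with D' b].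
Proof.
move=> K1 L0 B0; have [E E0 HE] := @fellow_ray K L D B K1 L0 B0.
have [|C C1 HC] := @recurrent_transfer R X Y K L E 16 K1 L0 E0; first by lra.
have [N [N1 HN]] := @contracting_recurrent R X D C C1.
have [N' N'1 HN'] := HC N N1.
exists E, (2 * (N' ^+ 2 + N' + 3)); split=> // f g a y0 fg aD ay.
have [b by0 ab] := HE f g a y0 fg aD ay; exists b; split=> //.
by apply: recurrent_contracting => //; apply: HN' fg ab _; exact: HN.
Qed.

End ImageRay.
(** * The map between contracting boundaries *)

Section BoundaryMap.
Context {R : realType}.

Lemma quasi_isometry_coarse_inverse (X Y : metricType R) (f : X -> Y) :
  quasi_isometry f -> exists K L g, coarse_inverse K L f g.
Proof.
move=> [K [L [K1 L0 [fKL fonto]]]].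
have K0 : 0 < K by lra.
have /choice[g hg] : forall y, exists x, mdist y (f x) < L by [].
have low s t : mdist s t <= K * (mdist (f s) (f t) + L).
  have /andP[h _] := fKL s t.
  rewrite -(ler_pM2l (_ : 0 < K^-1)) ?invr_gt0// mulrA mulVf ?gt_eqF// mul1r.
  by lra.
have KL : L <= K * L by rewrite ler_peMl.
(* The factor 3 comes from the upper bound for [g]: one [L] from each endpoint and one from the
   lower bound for [f]. *)
exists K, (3 * (K * L)), g; split=> //; first by lra.
- by move=> s t; have /andP[_ h] := fKL s t; lra.
- move=> s t; rewrite (le_trans (low _ _))//.
  have : mdist (f (g s)) (f (g t)) <= mdist s t + 2 * L.
    have := metric_triangle (f (g s)) s (f (g t)).
    have := metric_triangle s t (f (g t)).
    by have := hg s; have := hg t; rewrite (metric_sym s (f (g s))); lra.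
  by move=> h; have := ler_wpM2l (ltW K0) h; rewrite !mulrDr; lra.
- move=> x; rewrite (le_trans (low _ _))//.
  have := hg (f x); rewrite metric_sym => h.
  by have := ler_wpM2l (ltW K0) (ltW h); rewrite mulrDr; lra.
- by move=> y; rewrite metric_sym; have := hg y; lra.
Qed.

(** The times of two nearby points differ by at most [C] plus the distance of the origins, so
    synchronous points are close too. *)
Lemma endpoint_near (X : metricType R) (a b : ray X) (C : R) :
  (forall u, range a u -> exists2 v, range b v & mdist u v <= C) ->
  endpoint a = endpoint b.
Proof.
move=> ab; apply/endpoint_eqP.
exists (2 * C + mdist (ray_at a 0) (ray_at b 0)) => t.
have [v /range_rayP[s s0 ->] d1] := ab _ (ray_at_range a t%:num).
rewrite -!ray_atE.
have t0 : 0 <= t%:num by [].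
have e1 := ray_dist a (lexx 0) t0; have e2 := ray_dist b (lexx 0) s0.
rewrite sub0r normrN ger0_norm// in e1; rewrite sub0r normrN ger0_norm// in e2.
have q1 := metric_triangle (ray_at a 0) (ray_at b 0) (ray_at a t%:num).
have q2 := metric_triangle (ray_at b 0) (ray_at b s) (ray_at a t%:num).
have q3 := metric_triangle (ray_at b 0) (ray_at a 0) (ray_at b s).
have q4 := metric_triangle (ray_at a 0) (ray_at a t%:num) (ray_at b s).
rewrite (metric_sym (ray_at b s) (ray_at a _)) in q2.
rewrite (metric_sym (ray_at b 0) (ray_at a 0)) in q3.
have st : `|s - t%:num| <= C + mdist (ray_at a 0) (ray_at b 0).
  by rewrite ler_norml; apply/andP; split; lra.
rewrite (le_trans (metric_triangle _ (ray_at b s) _))// ray_dist//.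
by lra.
Qed.

(** This makes the boundary map well defined: asymptotic rays have asymptotic images. *)
Lemma fellow_endpoint (X Y : metricType R) (K L E : R) (f : X -> Y) g
    (a a' : ray X) (b b' : ray Y) : coarse_inverse K L f g ->
  fellow E f a b -> endpoint a = endpoint a' -> stays_near f a' b' ->
  endpoint b = endpoint b'.
Proof.
move=> fg [_ ba] /endpoint_eqP[C aa'] [C' ab'].
have K0 : 0 <= K by have := coarse_K fg; lra.
apply: (@endpoint_near Y b b' (E + (K * C + L) + C')) => u bu.
have [_ [t _ <-] h1] := ba _ bu; have [s h2] := ab' t.
exists (b' s); first by exists s.
have := ler_wpM2l K0 (aa' t); have := coarse_l fg (a t) (a' t).
have := metric_triangle u (f (a t)) (b' s); rewrite (metric_sym u (f _)).
by have := metric_triangle (f (a t)) (f (a' t)) (b' s); lra.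
Qed.

Lemma fellow_stays_near (X Y : metricType R) (E : R) (f : X -> Y) a b :
  fellow E f a b -> stays_near f a b.
Proof.
move=> [ab _]; exists E => t.
have [|_ [s _ <-] h] := ab (a t); first by exists t.
by exists s.
Qed.

(** * Rays with a common origin and the cone topology *)

Section Cone.
Variable X : metricType R.
Hypotheses (complete_X : complete_space X) (cat0_X : cat0 X).
Implicit Types a b : ray X.

Lemma ray_convex a b s t : origin a = origin b -> 0 <= t <= s -> 0 < s ->
  mdist (ray_at a t) (ray_at b t) <= t / s * mdist (ray_at a s) (ray_at b s).
Proof.
move=> ab /andP[t0 ts] s0.
have l : 0 <= t / s <= 1.
  by rewrite (divr_ge0 t0 (ltW s0))/= ler_pdivrMr// mul1r.
have sa := ray_segment a (ltW s0); have sb := ray_segment b (ltW s0).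
have da : mdist (origin a) (ray_at a s) = s.
  by rewrite -ray_at0 (ray_dist _ (lexx 0) (ltW s0)) sub0r normrN gtr0_norm.
have db : mdist (origin a) (ray_at b s) = s.
  by rewrite ab -ray_at0 (ray_dist _ (lexx 0) (ltW s0)) sub0r normrN gtr0_norm.
rewrite -ab in sb; have := cat0_convex cat0_X sa sb l.
by rewrite da db divfK ?gt_eqF.
Qed.

(** By convexity the distance at time [t] is at most [C t / s] for every large [s]. *)
Lemma endpoint_inj a b : origin a = origin b -> endpoint a = endpoint b ->
  forall t, 0 <= t -> ray_at a t = ray_at b t.
Proof.
move=> ab /endpoint_eqP[C abC] t t0.
apply/mdist_positivity/norm_le_all_eq0 => e e0.
have C0 : 0 <= C by apply: le_trans (abC 0%:nng); exact: mdist_ge0.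
rewrite ger0_norm ?mdist_ge0//.
have q0 : 0 <= t * C / e by rewrite divr_ge0 ?mulr_ge0// ltW.
have qE : t * C = t * C / e * e by rewrite divfK ?gt_eqF.
pose s := t + t * C / e + 1.
have s0 : 0 < s by rewrite /s; lra.
rewrite (le_trans (ray_convex ab _ s0))//; first by rewrite t0 /s; lra.
apply: (@le_trans _ _ (t / s * C)).
  by rewrite (ler_wpM2l (divr_ge0 t0 (ltW s0)))//; exact: (abC `|s|%:nng).
rewrite mulrAC ler_pdivrMr// qE [leRHS]mulrC ler_pM2r// /s; lra.
Qed.

(** The change of base point is the image ray construction for the identity. *)
Lemma contracting_representative (x0 : X) a : contracting a ->
  exists b, [/\ origin b = x0, contracting b & endpoint a = endpoint b].
Proof.
move=> [D aD].
have id1 : coarse_inverse 1 0 (@id X) (@id X).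
  by split=> // *; rewrite ?mul1r ?addr0 ?mdistxx.
have [E [D' [_ H]]] := image_ray (X := X) complete_X cat0_X D (lexx 1)
    (lexx 0) (mdist_ge0 (origin a) x0).
have [b [bx [ab _] bD]] := H _ _ _ _ id1 aD (lexx _).
by exists b; split=> //; [exists D' | exact: endpoint_near ab].
Qed.

(** Closeness at the single time [r] controls all earlier times by convexity and gives a set that is
    itself open. *)
Definition cone_ball a (r e : R) : set (boundary X) :=
  [set p | exists b, [/\ origin b = origin a, p = endpoint b &
    mdist (ray_at b r) (ray_at a r) < e]].

Lemma cone_ball_open (x0 : X) a (r e : R) : origin a = x0 -> 0 <= r ->
  @open (cone_boundary x0) (cone_ball a r e).
Proof.
move=> ax r0; suff : @cone_open R X x0 (cone_ball a r e) by [].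
move=> g gx [b [bx gb be]].
have gE := endpoint_inj (etrans gx (etrans (esym ax) (esym bx))) gb r0.
(* Basic neighbourhoods constrain only times strictly below their bound; [r + 1] includes time
   [r]. *)
exists (r + 1), (e - mdist (ray_at b r) (ray_at a r)); split; [lra | lra |].
move=> p [c [cg pc near]]; exists c; split=> //; first by rewrite cg gx.
have : mdist (ray_at c r) (ray_at g r) < e - mdist (ray_at b r) (ray_at a r).
  by have := near (NngNum r0); rewrite -!ray_atE /=; apply; lra.
rewrite gE; have := metric_triangle (ray_at c r) (ray_at b r) (ray_at a r); lra.
Qed.

End Cone.

(** * Existence and continuity of the boundary map *)

Section InducedMap.
Variables X Y : metricType R.
Hypotheses (complete_X : complete_space X) (cat0_X : cat0 X).
Hypotheses (complete_Y : complete_space Y) (cat0_Y : cat0 Y).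

(** Ranging over all representatives avoids base point changes in compositions. The target base
    point is free because the inverse must return to [x0], not to [g (f x0)]. *)
Definition boundary_map (f : X -> Y) (x0 : X) (y0 : Y)
    (h : limit_boundary x0 -> limit_boundary y0) : Prop :=
  forall p a b, set_val p = endpoint a -> stays_near f a b ->
    set_val (h p) = endpoint b.

Lemma boundary_map_exists (K L : R) (f : X -> Y) g (x0 : X) (y0 : Y) :
  coarse_inverse K L f g -> exists h, @boundary_map f x0 y0 h.
Proof.
move=> fg.
suff /choice[h hh] : forall p : limit_boundary x0, exists q : limit_boundary y0,
    forall a b, set_val p = endpoint a -> stays_near f a b ->
    set_val q = endpoint b by exists h.
move=> p; have [a [D aD] pa] := set_valP p.
have [E [D' [_ H]]] := image_ray (X := X) complete_Y cat0_Y D (coarse_K fg)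
  (coarse_L fg) (mdist_ge0 (f (origin a)) y0).
have [b [by0 ab bD]] := H _ _ _ _ fg aD (lexx _).
have bc : contracting_boundary (endpoint b) by exists b => //; exists D'.
exists (exist _ (endpoint b) (mem_set bc)) => a' b' pa' ab'.
by rewrite set_valE /=; apply: fellow_endpoint fg ab _ ab'; rewrite -pa -pa'.
Qed.

(* The image rays are close at about time [A], hence until then by convexity. *)
Lemma image_rays_close (K L E B A G : R) (f : X -> Y) g (a a' : ray X)
    (b b' : ray Y) (r : R) :
  coarse_inverse K L f g -> fellow E f a b -> fellow E f a' b' ->
  origin b = origin b' -> mdist (f (origin a)) (origin b) <= B ->
  r = K * (A + B + E) + 3 * L -> 0 < A -> 0 <= B -> 0 <= E ->
  G = 2 * (2 * E + K + L) ->
  mdist (ray_at a' r) (ray_at a r) <= 1 -> forall t, 0 <= t <= A ->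
  mdist (ray_at b' t) (ray_at b t) <= t / A * G.
Proof.
move=> fg [ab _] [ab' _] bb' aB rE A0 B0 E0 GE aa' t ht.
have K0 : 0 < K by have := coarse_K fg; lra.
have L0 := coarse_L fg.
have r0 : 0 <= r by rewrite rE addr_ge0 ?mulr_ge0 ?addr_ge0// ltW.
have [_ /range_rayP[s s0 ->] as_] := ab _ (ray_at_range a r).
have [_ /range_rayP[s' s'0 ->] as_'] := ab' _ (ray_at_range a' r).
have ds : mdist (origin b) (ray_at b s) = s.
  by rewrite -ray_at0 ray_dist// sub0r normrN ger0_norm.
have ds' : mdist (origin b) (ray_at b' s') = s'.
  by rewrite bb' -ray_at0 ray_dist// sub0r normrN ger0_norm.
have ss' : mdist (ray_at b' s') (ray_at b s) <= 2 * E + K + L.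
  have := coarse_l fg (ray_at a' r) (ray_at a r).
  have := metric_triangle (ray_at b' s') (f (ray_at a' r)) (ray_at b s).
  have := metric_triangle (f (ray_at a' r)) (f (ray_at a r)) (ray_at b s).
  have := ler_wpM2l (ltW K0) aa'.
  rewrite (metric_sym (ray_at b' s') (f _)); lra.
have As : A <= s.
  (* The value of [r] is chosen so that the lower bound for [f] forces [A <= s]. *)
  have := coarse_lower (origin a) (ray_at a r) fg.
  rewrite -{1}ray_at0 ray_dist// sub0r normrN ger0_norm//.
  rewrite {1}rE lerD2r ler_pM2l//.
  have := metric_triangle (f (origin a)) (origin b) (f (ray_at a r)).
  have := metric_triangle (origin b) (ray_at b s) (f (ray_at a r)).
  by rewrite ds (metric_sym (ray_at b s)); lra.
have /andP[t0 tA] := ht.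
have hs : 0 <= t <= s by rewrite t0 (le_trans tA).
have sp : 0 < s by lra.
rewrite (le_trans (ray_convex cat0_Y (esym bb') hs sp))//.
apply: (@le_trans _ _ (t / s * G)).
  rewrite ler_wpM2l ?divr_ge0// GE.
  rewrite (le_trans (metric_triangle _ (ray_at b' s') _))//.
  have : mdist (ray_at b' s) (ray_at b' s') <= 2 * E + K + L; last by lra.
  have := mdist_triangle_rev (origin b) (ray_at b' s') (ray_at b s).
  by rewrite ds ds' ray_dist// distrC => /le_trans; apply.
rewrite ler_wpM2r//; first by rewrite GE; lra.
by rewrite ler_wpM2l// lef_pV2.
Qed.

(** Uniformity of [image_ray] sends the [n]-th stratum into a single stratum [n'], so it is enough
    that this restriction is continuous for the cone topologies. *)
Lemma boundary_map_continuous (K L : R) (f : X -> Y) g (x0 : X) (y0 : Y) h :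
  coarse_inverse K L f g -> @boundary_map f x0 y0 h -> continuous h.
Proof.
move=> fg fh; apply/continuous_closedP => V /limit_closedP cV.
apply/limit_closedP => n.
have [E [D' [E0 H]]] := image_ray (X := X) complete_Y cat0_Y n%:R (coarse_K fg)
  (coarse_L fg) (mdist_ge0 (f x0) y0).
have K0 : 0 < K by have := coarse_K fg; lra.
have L0 := coarse_L fg.
pose n' := (Num.truncn D').+1.
have image (p : set_type (@contracting_stratum R X x0 n)) a : origin a = x0 ->
    set_val p = endpoint a -> contracting_with n%:R a ->
    exists b, [/\ origin b = y0, fellow E f a b, contracting_with n'%:R b &
      set_val (h (stratum_incl p)) = endpoint b].
  move=> ax pa aD.
  have [|b [by0 ab bD]] := H _ _ _ y0 fg aD; first by rewrite ax.
  exists b; split=> //; last first.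
    exact: (fh (stratum_incl p) a b pa (fellow_stays_near ab)).
  by apply: contracting_with_le bD; apply/ltW/truncnS_gt.
have stratum (p : set_type (@contracting_stratum R X x0 n)) :
    @contracting_stratum R Y y0 n' (set_val (h (stratum_incl p))).
  have [a [ax aD pa]] := set_valP p.
  by have [b [by0 _ bD hb]] := image p a ax pa aD; exists b.
pose hn (p : set_type (@contracting_stratum R X x0 n)) :
  set_type (@contracting_stratum R Y y0 n') :=
  exist _ (set_val (h (stratum_incl p))) (mem_set (stratum p)).
have -> : @stratum_incl R X x0 n @^-1` (h @^-1` V) =
    hn @^-1` (@stratum_incl R Y y0 n' @^-1` V).
  apply/seteqP; split=> p /=;
  by rewrite (_ : stratum_incl (hn p) = h (stratum_incl p))//; exact: val_inj.
apply: (continuous_closedP hn).1; last exact: cV.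
apply: continuous_comp_initial.
move=> p W; rewrite nbhsE => -[W' [oW' W'p] W'W].
have [a [ax aD pa]] := set_valP p.
have [b [by0 ab _ hb]] := image p a ax pa aD.
have cW' : @cone_open R Y y0 W' := oW'.
have [|r [e [r0 e0 bW]]] := cW' b by0; first by rewrite -hb.
pose B := mdist (f x0) y0.
pose G := 2 * (2 * E + K + L).
have G0 : 0 <= G by rewrite /G; lra.
pose q := r * G / e.
have q0 : 0 <= q by exact: divr_ge0 (mulr_ge0 (ltW r0) G0) (ltW e0).
have qE : r * G = q * e by rewrite divfK ?gt_eqF.
(* Large enough that [r * G / A < e], where [t / A * G] bounds the distance of the image rays at
   time [t]. *)
pose A := r + q + 1.
have A0 : 0 < A by rewrite /A; lra.
have B0 : 0 <= B by exact: mdist_ge0.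
pose s := K * (A + B + E) + 3 * L.
have s0 : 0 <= s.
  have : 0 <= K * (A + B + E) by rewrite (mulr_ge0 (ltW K0))//; lra.
  by rewrite /s; lra.
have oO := @cone_ball_open X cat0_X x0 a s 1 ax s0.
rewrite nbhsE; exists (set_val @^-1` cone_ball a s 1).
  split; first by exists (cone_ball a s 1).
  by exists a; split; rewrite ?mdistxx.
move=> p' [a' [a'x p'a' near]]; apply: W'W; apply: bW.
have [a2 [a2x a2D p'a2]] := set_valP p'.
have [b' [b'y a2b' _ hb']] := image p' a2 a2x p'a2 a2D.
exists b'; split=> //; first by rewrite by0.
move=> t tr.
(* The contracting representative [a2] of [p'] agrees with the representative [a'] given by the cone
   ball. *)
have a2E := endpoint_inj cat0_X (etrans a2x (etrans (esym ax) (esym a'x)))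
  (etrans (esym p'a2) p'a') s0.
have t0 : 0 <= t%:num by [].
have tA : 0 <= t%:num <= A by rewrite t0 /A; lra.
have := @image_rays_close K L E B A G f g a a2 b b' s fg ab a2b'.
rewrite by0 b'y ax a2E.
move=> /(_ erefl (lexx _) erefl A0 B0 E0 erefl (ltW near) _ tA).
rewrite !ray_atE => /le_lt_trans; apply.
rewrite mulrAC ltr_pdivrMr//; apply: (@le_lt_trans _ _ (r * G)).
  by rewrite ler_wpM2r// ltW.
by rewrite qE mulrC ltr_pM2l// /A; lra.
Qed.

End InducedMap.
End BoundaryMap.

(** If [b] follows the image of [a] under [f], then [a] follows the image of [b] under [g], so [a]
    represents the image of the endpoint of [b]. *)
Lemma boundary_mapK (R : realType) (X Y : metricType R) (K L : R)
    (f : X -> Y) (g : Y -> X) (x0 : X) (y0 : Y) h k :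
  complete_space Y -> cat0 Y -> coarse_inverse K L f g ->
  @boundary_map R X Y f x0 y0 h -> @boundary_map R Y X g y0 x0 k -> cancel h k.
Proof.
move=> cY cat0_Y fg fh gk p; apply: val_inj.
have [a [D aD] pa] := set_valP p.
have [E [D' [_ H]]] := image_ray (X := X) cY cat0_Y D (coarse_K fg)
  (coarse_L fg) (mdist_ge0 (f (origin a)) y0).
have [b [by0 ab bD]] := H _ _ _ _ fg aD (lexx _).
have hb := fh p a b pa (fellow_stays_near ab).
rewrite -!set_valE (gk _ b a hb) //.
have K0 : 0 <= K by have := coarse_K fg; lra.
exists (K * E + L + L) => t.
have [|_ [s _ <-] d] := ab.2 (b t); first by exists t.
exists s; have := coarse_lr fg (a s); have := coarse_r fg (b t) (f (a s)).
have := ler_wpM2l K0 d; rewrite (metric_sym (b t)).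
by have := metric_triangle (g (b t)) (g (f (a s))) (a s); lra.
Qed.

Theorem theorem3p10 (R : realType) (X Y : metricType R)
    (complete_X : complete_space X) (cat0_X : cat0 X)
    (complete_Y : complete_space Y) (cat0_Y : cat0 Y)
    (f : X -> Y) (f_qi : quasi_isometry f) (x0 : X) :
  exists h : limit_boundary x0 -> limit_boundary (f x0),
    unique (@induced_map R X Y f x0) h /\ homeomorphism h.
Proof.
have [K [L [g fg]]] := quasi_isometry_coarse_inverse f_qi.
have gf := coarse_inverse_sym fg.
have [h fh] := boundary_map_exists complete_Y cat0_Y x0 (f x0) fg.
have [k gk] := boundary_map_exists complete_X cat0_X (f x0) x0 gf.
exists h; split; last first.
  split; first exact: boundary_map_continuous fg fh.
  exists k; split; last exact: boundary_map_continuous gf gk.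
  - exact: boundary_mapK fg fh gk.
  - exact: boundary_mapK gf gk fh.
split=> [p a ax [D aD] pa|h' ih'].
  have [E [D' [_ H]]] := image_ray (X := X) complete_Y cat0_Y D (coarse_K fg)
    (coarse_L fg) (lexx 0).
  have [|b [by0 ab bD]] := H _ _ _ (f x0) fg aD; first by rewrite ax mdistxx.
  have near := fellow_stays_near ab.
  by exists b; split=> //; [exists D' | exact: fh near].
apply/funext => p; apply: val_inj; rewrite -!set_valE.
have [a0 a0c pa0] := set_valP p.
(* The hypothesis on [h'] concerns rays from [x0] only, so the representative is first moved
   there. *)
have [a [ax ac a0a]] := contracting_representative complete_X cat0_X x0 a0c.
have [b [_ _ near ->]] := ih' p a ax ac (etrans pa0 a0a).
exact: fh (etrans pa0 a0a) near.
Qed.
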